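(* Let $\mu$ be a finite positive Borel measure on $(-1,1)$ that is regular. Let $I$ be a closed subinterval of $(-1,1)$ (possibly consisting of a single point) such that $\mu$ is absolutely continuous in an open interval containing $I$. Assume that $w$ is positive and continuous in $I$ (that is, $w$, regarded as a function on $(-1,1)$, is continuous at every point of $I$). Then, uniformly for $x\in I$ and for $a,b$ in compact subsets of the real line, $$\lim_{n\to\infty}\frac{\widetilde K_n\left(x+\frac{a}{\widetilde K_n(x,x)},\,x+\frac{b}{\widetilde K_n(x,x)}\right)}{\widetilde K_n(x,x)}=\frac{\sin\pi(a-b)}{\pi(a-b)}.$$
   Context: For a finite positive Borel measure $\mu$ on $(-1,1)$ with infinite support, the orthonormal polynomials are $p_n(x)=\gamma_n x^n+\cdots$, $\gamma_n>0$, $n\ge 0$, with $\int_{-1}^1 p_np_m\,d\mu=\delta_{mn}$. The measure $\mu$ is called regular (on $[-1,1]$) if $\lim_{n\to\infty}\gamma_n^{1/n}=2$. The function $w=d\mu/dx$ denotes (a fixed version of) the density of the absolutely continuous part of $\mu$. The reproducing kernel is $K_n(x,y)=\sum_{k=0}^{n-1}p_k(x)p_k(y)$ and the normalized kernel is $\widetilde K_n(x,y)=w(x)^{1/2}w(y)^{1/2}K_n(x,y)$. When $a=b$, $\frac{\sin\pi(a-b)}{\pi(a-b)}$ is interpreted as $1$. *)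

(* Defs.v *)
From HB Require Import structures.
From mathcomp Require Import all_boot all_order all_algebra.
From mathcomp Require Import all_classical all_reals all_analysis.

Set Implicit Arguments.
Unset Strict Implicit.
Unset Printing Implicit Defensive.

Import Order.TTheory GRing.Theory Num.Theory.
Import numFieldNormedType.Exports.

Local Open Scope classical_set_scope.
Local Open Scope ring_scope.

(* Borel measures on (-1, 1) are represented by Borel measures on R for which
   the complement of ]-1, 1[ is null. *)
Definition lives_on (R : realType) (D : set R)
    (mu : set (measurableTypeR R) -> \bar R) : Prop :=
  mu (~` D) = 0%E.

Definition support_of (R : realType)
    (mu : set (measurableTypeR R) -> \bar R) : set R :=
  [set x : R | forall U : set R, open U -> U x -> (0%E < mu U)%E].

Definition mutually_singular d (T : measurableType d) (R : realType)
    (nu1 nu2 : set T -> \bar R) : Prop :=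
  exists N : set T, [/\ measurable N, nu1 N = 0%E & nu2 (~` N) = 0%E].

(* w is a version on ]-1, 1[ of the density of the absolutely continuous part
   of mu: mu = w dx + nu is its Lebesgue decomposition there. The values of w
   outside ]-1, 1[ are irrelevant. *)
Definition is_ac_density (R : realType)
    (mu : {finite_measure set (measurableTypeR R) -> \bar R}) (w : R -> R) :
    Prop :=
  [/\ measurable_fun (`]-1, 1[%classic : set (measurableTypeR R)) w,
      forall x : R, x \in `]-1, 1[ -> 0 <= w x &
      exists nu : {measure set (measurableTypeR R) -> \bar R},
        mutually_singular nu lebesgue_measure /\
        forall A : set (measurableTypeR R), measurable A ->
          A `<=` `]-1, 1[%classic ->
          mu A = (\int[lebesgue_measure]_(x in A) (w x)%:E + nu A)%E].

Definition is_orthonormal_polys (R : realType)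
    (mu : {finite_measure set (measurableTypeR R) -> \bar R})
    (p : nat -> {poly R}) : Prop :=
  [/\ forall n, size (p n) = n.+1,
      forall n, 0 < lead_coef (p n) &
      forall m n,
        (\int[mu]_(x in `](-1)%R, 1%R[%classic) ((p m).[x] * (p n).[x])%:E)%E
          = ((m == n)%:R : R)%:E].

(* The measure enters through its orthonormal polynomials p, which it
   determines uniquely. *)
Definition is_regular (R : realType) (p : nat -> {poly R}) : Prop :=
  (lead_coef (p n) `^ (n%:R^-1)) @[n --> \oo] --> (2 : R).

Definition kernel_K (R : realType) (p : nat -> {poly R}) (n : nat) (x y : R) :
    R :=
  \sum_(k < n) (p k).[x] * (p k).[y].

Definition kernel_Kt (R : realType) (w : R -> R) (p : nat -> {poly R})
    (n : nat) (x y : R) : R :=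
  Num.sqrt (w x) * Num.sqrt (w y) * kernel_K p n x y.

Definition sine_kernel (R : realType) (a b : R) : R :=
  if a == b then 1 else sin (pi * (a - b)) / (pi * (a - b)).

(* Main.v *)
(* The measure mu is compared with c sqrt(1-x^2) dx, whose kernel H_n is an
   explicit Dirichlet sum with the sine kernel as scaling limit. Near x0 the two
   measures agree up to a factor 1 + eta for a suitable constant c; the part of
   mu away from x0 is made negligible by the factor (1-((t-x)/2)^2)^m with
   m = [eta n], which equals 1 at x and decays geometrically off a
   neighbourhood of x0. Testing extremality of H_{n+2m} on K_n(x,.) times this
   factor bounds K_n(x,x) from above; testing mu on G = H_{n-2m}(x,.) times this
   factor, the reproducing property gives
     int (K_n(x,.) - G)^2 dmu <= K_n(x,x) - H_{n-2m}(x,x)/c + o(1) = O(eta) n,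
   and the Christoffel inequality at y turns this into K_n(x,y) = G(y) + small.
   This is Lubinsky's comparison argument, carried out without auxiliary
   orthogonal polynomials.

   Regularity is needed only to know that |p_n| <= C e^(eps n) on [-1,1]. When
   mu is lifted to the unit circle, regularity forces the product of the factors
   1 - al_k^2 (al_k the Verblunsky coefficients) to decay subexponentially, so
   the mean of |al_k| tends to 0, while |p_n| is at most 2 (gamma_n / 2^n) times
   the product of the factors 1 + |al_k|. *)
Require Import Defs.
From HB Require Import structures.
From mathcomp Require Import all_boot all_order all_algebra.
From mathcomp Require Import all_classical all_reals all_analysis.
From mathcomp Require Import measurable_realfun.
From mathcomp Require Import zify ring lra.

Import Order.TTheory GRing.Theory Num.Theory.
Import numFieldNormedType.Exports.

Local Open Scope classical_set_scope.
Local Open Scope ring_scope.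

Set Implicit Arguments.
Unset Strict Implicit.
Unset Printing Implicit Defensive.

(** * Chebyshev polynomials of the first kind *)

(** The exponent m has to be proportional to n: only then does the decay of the bump power away from
    x0 beat the growth e^(eps n), where eps is chosen after eta. The price is a shift of the degree
    by 2m, a relative error of order eta, so n tends to infinity at fixed eta and eta tends to 0
    afterwards. At the points y of interest the bump costs nothing: |y - x| = O(1/n) gives m (y -
    x)^2 -> 0.

    The constant is c = w(x0) / sqrt(1 - x0^2) up to a factor 1 + eta, which comes from the
    continuity of w and of the Chebyshev weight at x0.

    Uniformity is not carried through the estimates. The limits are taken along an arbitrary filter,
    with an index N i -> oo and points X i, Y i -> x0 moving together; joint limits at each point of
    a compact set then give the uniform statement. As the test functions are all polynomials, each
    measure acts only through a linear functional on polynomials once two comparison inequalities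
    are known. *)

Section ChebyshevPolynomials.
Variable R : realType.

Fixpoint chebT (n : nat) : {poly R} :=
  if n is m.+1 then if m is q.+1 then 'X * chebT m *+ 2 - chebT q else 'X
  else 1.

Arguments chebT n : simpl never.

(** The even extension, matching cos (-t) = cos t, makes the product formula [chebTzM] hold without
    the condition k <= j; negative indices do occur in the Szego recursion. *)
Definition chebTz (j : int) : {poly R} := chebT `|j|%N.

Lemma chebTS n : chebT n.+2 = 'X * chebT n.+1 *+ 2 - chebT n.
Proof. by []. Qed.

Lemma chebT_ind (P : nat -> Prop) :
  P 0 -> P 1 -> (forall n, P n -> P n.+1 -> P n.+2) -> forall n, P n.
Proof.
move=> P0 P1 PS n; suff: P n /\ P n.+1 by case.
by elim: n => // n [? ?]; split=> //; apply: PS.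
Qed.

Lemma size_chebT_lead n :
  size (chebT n) = n.+1 /\ (chebT n)`_n = if n is m.+1 then 2 ^+ m else 1.
Proof.
elim/chebT_ind: n.
- by rewrite size_poly1 coef1.
- by rewrite size_polyX coefX.
move=> n [sn cn] [sn1 cn1].
have c : (chebT n.+2)`_n.+2 = 2 ^+ n.+1.
  rewrite chebTS coefB coefMn coefXM /= cn1 nth_default ?sn // subr0.
  by rewrite exprS mulr_natl.
split=> //; apply/eqP; rewrite eqn_leq; apply/andP; split.
  have sX : (size ('X * chebT n.+1)%R <= n.+3)%N.
    by apply: leq_trans (size_polyMleq _ _) _; rewrite size_polyX sn1.
  rewrite chebTS mulr2n; apply: leq_trans (size_polyD _ _) _.
  rewrite geq_max size_polyN sn -addn2 leq_addr andbT addn2.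
  by apply: leq_trans (size_polyD _ _) _; rewrite geq_max sX.
rewrite ltnNge; apply/negP => /(nth_default 0); rewrite c.
by move/eqP; rewrite expf_eq0 /= pnatr_eq0.
Qed.

Lemma size_chebT n : size (chebT n) = n.+1.
Proof. by case: (size_chebT_lead n). Qed.

Lemma coef_chebTS n : (chebT n.+1)`_n.+1 = 2 ^+ n.
Proof. by case: (size_chebT_lead n.+1). Qed.

Lemma horner_chebT n (t : R) : (chebT n).[cos t] = cos (n%:R * t).
Proof.
elim/chebT_ind: n.
- by rewrite mul0r cos0 hornerE.
- by rewrite mul1r hornerE.
move=> n IH0 IH1; rewrite chebTS !hornerE /= IH0 IH1.
have -> : n.+2%:R * t = n.+1%:R * t + t by rewrite -[in LHS]natr1 mulrDl mul1r.
have -> : n%:R * t = n.+1%:R * t - t by rewrite -[n.+1%:R]natr1 mulrDl mul1r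
  addrK.
by rewrite cosB cosD; ring.
Qed.

Lemma horner_chebTz (j : int) (t : R) : (chebTz j).[cos t] = cos (j%:~R * t).
Proof.
rewrite /chebTz horner_chebT; case: (intP j) => [|n|n] //.
by rewrite abszN mulrNz mulNr cosN.
Qed.

Lemma chebTzN j : chebTz (- j) = chebTz j.
Proof. by rewrite /chebTz abszN. Qed.

Lemma chebTz_rec j : chebTz (j + 1) + chebTz (j - 1) = 'X * chebTz j *+ 2.
Proof.
wlog: j / 0 <= j => [hw|].
  case: (leP 0 j) => [/hw//|j0]; have := hw (- j).
  rewrite oppr_ge0 ltW // => /(_ isT); rewrite chebTzN => <-.
  by rewrite -[in LHS]chebTzN -[chebTz (j - 1)]chebTzN !opprD opprK addrC.
case: j => // -[|n] _; first by rewrite /chebTz /= mulr1 mulr2n.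
have -> : n.+1%:Z + 1 = n.+2%:Z by lia.
have -> : n.+1%:Z - 1 = n%:Z by lia.
by rewrite /chebTz !absz_nat chebTS subrK.
Qed.

Lemma chebTzM j k :
  chebTz (j + k%:Z) + chebTz (j - k%:Z) = chebT k * chebTz j *+ 2.
Proof.
elim/chebT_ind: k j => [j|j|k IH0 IH1 j].
- by rewrite mul1r mulr2n; congr (chebTz _ + chebTz _); lia.
- by rewrite chebTz_rec.
have recp m : chebTz (m + 1) = 'X * chebTz m *+ 2 - chebTz (m - 1).
  by rewrite -chebTz_rec addrK.
have recm m : chebTz (m - 1) = 'X * chebTz m *+ 2 - chebTz (m + 1).
  by rewrite -chebTz_rec addrAC subrr add0r.
have -> : j + k.+2%:Z = (j + k.+1%:Z) + 1 by rewrite -addrA -PoszD addn1.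
have -> : j - k.+2%:Z = (j - k.+1%:Z) - 1 by rewrite -addrA -opprD -PoszD addn1.
rewrite recp (recm (j - k.+1%:Z)).
have -> : j + k.+1%:Z - 1 = j + k%:Z by rewrite -addn1 PoszD addrA addrK.
have -> : j - k.+1%:Z + 1 = j - k%:Z by rewrite -addn1 PoszD opprD addrA subrK.
rewrite addrACA -opprD IH0 -mulrnDl -mulrDr IH1 chebTS mulrBl mulrnBl.
by rewrite mulrnAl mulrnAr mulrA.
Qed.

Lemma chebT_le1 n (x : R) : -1 <= x <= 1 -> `|(chebT n).[x]| <= 1.
Proof.
move=> xI; rewrite -[x]acosK ?in_itv//= horner_chebT.
by rewrite ler_norml cos_geN1 cos_le1.
Qed.

End ChebyshevPolynomials.
Arguments chebT R n : simpl never.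

(** * Reproducing kernels of positive functionals on polynomials *)

Lemma poly_basis_expand (R : fieldType) (p : nat -> {poly R})
  (psz : forall n, size (p n) = n.+1) n (Q : {poly R}) : (size Q <= n)%N ->
  exists c : nat -> R, Q = \sum_(k < n) c k *: p k.
Proof.
elim: n Q => [|n IH] Q sQ.
  exists (fun=> 0); rewrite big_ord0; apply/eqP.
  by rewrite -size_poly_eq0 -leqn0.
have ln0 : lead_coef (p n) != 0 by rewrite lead_coef_eq0 -size_poly_eq0 psz.
pose a := Q`_n / lead_coef (p n).
have /IH [c Qc] : (size (Q - a *: p n)%R <= n)%N.
  apply/leq_sizeP => j; rewrite leq_eqVlt => /predU1P[<-|nj].
    rewrite coefB coefZ /a (_ : (p n)`_n = lead_coef (p n)) ?divfK ?subrr //.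
    by rewrite lead_coefE psz.
  rewrite coefB coefZ !nth_default ?psz ?mulr0 ?subr0 //.
  exact: leq_trans nj.
exists (fun k => if k == n then a else c k).
rewrite big_ord_recr /= eqxx -[LHS](subrK (a *: p n)) Qc; congr (_ + _).
by apply: eq_bigr => k _; rewrite (ltn_eqF (ltn_ord k)).
Qed.

Section OrthonormalPolynomials.
Variables (R : realType) (L : {scalar {poly R}}) (p : nat -> {poly R}).

(** Stands for integration against a measure on ]-1, 1[, so that the algebra below applies both to
    mu and to the Chebyshev weight. *)
Definition nonneg_functional :=
  forall P : {poly R}, (forall x, -1 < x < 1 -> 0 <= P.[x]) -> 0 <= L P.

Definition orthonormal_for :=
  (forall n, size (p n) = n.+1) /\
  (forall m n, L (p m * p n) = (m == n)%:R).

Definition kernel_poly n x : {poly R} := \sum_(k < n) (p k).[x] *: p k.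

Lemma horner_kernel_poly n x y : (kernel_poly n x).[y] = kernel_K p n x y.
Proof. by rewrite horner_sum; apply: eq_bigr => k _; rewrite hornerZ. Qed.

Hypothesis Lpos : nonneg_functional.
Hypothesis Lorth : orthonormal_for.

Let psz n : size (p n) = n.+1. Proof. by case: Lorth. Qed.
Let porth m n : L (p m * p n) = (m == n)%:R. Proof. by case: Lorth. Qed.

Lemma size_kernel_poly n x : (size (kernel_poly n x) <= n)%N.
Proof.
apply: (leq_trans (size_sum _ _ _)); apply/bigmax_leqP => k _.
by apply: leq_trans (size_scale_leq _ _) _; rewrite psz.
Qed.

Let ortho_expand n (Q : {poly R}) : (size Q <= n)%N ->
  exists c : nat -> R, Q = \sum_(k < n) c k *: p k.
Proof. exact: poly_basis_expand. Qed.

Lemma functionalZ a P : L (a *: P) = a * L P. Proof. exact: linearZ. Qed.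

Lemma functional_sumZ (c : nat -> R) n (Q : {poly R}) :
  L (Q * \sum_(k < n) c k *: p k) = \sum_(k < n) c k * L (Q * p k).
Proof.
rewrite mulr_sumr linear_sum; apply: eq_bigr => k _.
by rewrite -scalerAr linearZ.
Qed.

Lemma functional_sumM (c : nat -> R) n m :
  L ((\sum_(k < n) c k *: p k) * p m) = if (m < n)%N then c m else 0.
Proof.
rewrite mulrC functional_sumZ; case: ifP => [mn|/negbT].
  rewrite (bigD1 (Ordinal mn)) //= porth eqxx mulr1 big1 ?addr0 // => i ne.
  rewrite porth; case: eqP => [e|]; last by rewrite mulr0.
  by case/eqP: ne; apply: val_inj.
rewrite -leqNgt => nm; rewrite big1 // => i _; rewrite porth.
by rewrite gtn_eqF ?mulr0 // (leq_trans (ltn_ord i)).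
Qed.

Lemma ortho_lower (Q : {poly R}) m : (size Q <= m)%N -> L (Q * p m) = 0.
Proof.
by move=> /ortho_expand[c ->]; rewrite functional_sumM ltnn.
Qed.

Lemma kernel_poly_repro (Q : {poly R}) n x :
  (size Q <= n)%N -> L (Q * kernel_poly n x) = Q.[x].
Proof.
move=> sQ; have [c Qc] := ortho_expand sQ.
rewrite /kernel_poly (functional_sumZ (fun k => (p k).[x])) {2}Qc horner_sum.
apply: eq_bigr => k _; rewrite Qc functional_sumM ltn_ord hornerZ mulrC.
by [].
Qed.

Lemma kernel_poly_sqr n x : L (kernel_poly n x ^+ 2) = kernel_K p n x x.
Proof.
by rewrite expr2 kernel_poly_repro ?size_kernel_poly // horner_kernel_poly.
Qed.

Lemma kernel_K_gt0 n x : (0 < n)%N -> 0 < kernel_K p n x x.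
Proof.
case: n => // n _; rewrite /kernel_K big_ord_recl ltr_wpDr //.
  by apply: sumr_ge0 => k _; rewrite -expr2 sqr_ge0.
have /size_poly1P[c c0 ->] : size (p 0) == 1%N by rewrite psz.
by rewrite hornerC -expr2 lt_def sqrf_eq0 c0 sqr_ge0.
Qed.

Lemma functional_sqr_ge0 (Q : {poly R}) : 0 <= L (Q ^+ 2).
Proof. by apply: Lpos => x _; rewrite horner_exp sqr_ge0. Qed.

(** The Christoffel inequality: expand L ((K Q - Q(x) K_n(x,.))^2) >= 0 by the reproducing property
    and divide by K = K_n(x,x) > 0. *)
Lemma kernel_poly_cs (Q : {poly R}) n x : (0 < n)%N -> (size Q <= n)%N ->
  Q.[x] ^+ 2 <= kernel_K p n x x * L (Q ^+ 2).
Proof.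
move=> n0 sQ; have K0 := kernel_K_gt0 x n0; set K := kernel_K p n x x in K0 *.
have := functional_sqr_ge0 (K *: Q - Q.[x] *: kernel_poly n x).
have -> : (K *: Q - Q.[x] *: kernel_poly n x) ^+ 2 =
    (K ^+ 2) *: Q ^+ 2 - (K * Q.[x] * 2) *: (Q * kernel_poly n x)
    + (Q.[x] ^+ 2) *: kernel_poly n x ^+ 2.
  by rewrite -!mul_polyC; ring.
rewrite raddfD raddfB /= !functionalZ kernel_poly_repro // kernel_poly_sqr -/K.
have -> : K ^+ 2 * L (Q ^+ 2) - K * Q.[x] * 2 * Q.[x] + Q.[x] ^+ 2 * K
  = K * (K * L (Q ^+ 2) - Q.[x] ^+ 2) by ring.
by rewrite pmulr_rge0 // subr_ge0.
Qed.

(** By Parseval, L (Q^2) is the sum of the squared coefficients of Q in the basis p. This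
    definiteness justifies the divisions in the Szego recursion. *)
Lemma functional_sqr_gt0 (Q : {poly R}) : Q != 0 -> 0 < L (Q ^+ 2).
Proof.
move=> Q0; rewrite lt_def functional_sqr_ge0 andbT; apply: contraNneq Q0 => e.
move: (leqnn (size Q)); move: {2}(size Q) => n /ortho_expand[c Qc].
have : \sum_(k < n) c k ^+ 2 == 0.
  suff <- : L (Q ^+ 2) = \sum_(k < n) c k ^+ 2 by rewrite e.
  rewrite expr2 {2}Qc functional_sumZ; apply: eq_bigr => k _.
  by rewrite Qc functional_sumM ltn_ord expr2.
rewrite psumr_eq0 => [/allP c0|k _]; last exact: sqr_ge0.
rewrite Qc big1 // => k _; have /c0 := mem_index_enum k.
by rewrite /= sqrf_eq0 => /eqP ->; rewrite scale0r.
Qed.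

End OrthonormalPolynomials.

(** * Szego recursion and subexponential growth *)

Section SzegoRecursion.
Variables (R : realType) (L : {scalar {poly R}}) (p : nat -> {poly R}).
Hypothesis Lpos : nonneg_functional L.
Hypothesis Lorth : orthonormal_for L p.
Local Notation Tz := (@chebTz R).

(* Let Phi_n be the monic orthogonal polynomials of the lift of L to the unit
   circle and Phi'_n the reversed ones, Phi_(n+1) = z Phi_n - al_n Phi'_n. Then
   szego n j is Re (z^(-j) Phi_n(z)), z = e^(it), as a polynomial in cos t.
   Since Re (z^(-j) Phi'_n) = Re (z^(j-n) Phi_n) on the circle, the Szego
   recursion closes up on these real parts. *)
Fixpoint szego (n : nat) : int -> {poly R} :=
  if n is m.+1 then fun j => szego m (j - 1)
    - (L (szego m (- 1)) / L (szego m m%:Z)) *: szego m (m%:Z - j)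
  else Tz.

Arguments szego n j : simpl never.

(** The integral of z Phi_n over the squared norm of Phi_n; this choice makes [szego n.+1 0] have
    zero integral. *)
Definition verblunsky n : R := L (szego n (- 1)) / L (szego n n%:Z).

Local Notation u n j := (L (szego n j)).
Local Notation al := verblunsky.

Lemma szegoS n j :
  szego n.+1 j = szego n (j - 1) - al n *: szego n (n%:Z - j).
Proof. by []. Qed.

(** The identity 2 cos(kt) Re(z^(-j) Phi_n) = Re(z^(-j-k) Phi_n) + Re(z^(-j+k) Phi_n). It passes
    through the recursion because j - 1 and n - j both carry a pair j + k, j - k to a pair of the
    same shape. *)
Lemma szegoM n j k :
  szego n (j + k%:Z) + szego n (j - k%:Z) = chebT R k * szego n j *+ 2.
Proof.
elim: n j => [|n IH] j; first exact: chebTzM.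
rewrite !szegoS.
have -> : n%:Z - (j + k%:Z) = (n%:Z - j) - k%:Z by rewrite opprD addrA.
have -> : n%:Z - (j - k%:Z) = (n%:Z - j) + k%:Z by rewrite opprB addrCA addrC.
rewrite ![j + _ - 1]addrAC addrACA IH -opprD -scalerDr.
by rewrite [X in _ *: X]addrC IH mulrBr mulrnBl -scalerAr -scalerMnr.
Qed.

(** The [f i] are the coefficients of the monic polynomial Phi_n. *)
Lemma szego_coef n : exists f : nat -> R, f n = 1 /\
  forall m, szego n m = \sum_(i < n.+1) f i *: Tz (i%:Z - m).
Proof.
elim: n => [|n [f [fn IH]]].
  exists (fun=> 1); split=> // m.
  by rewrite big_ord1 scale1r sub0r chebTzN.
(* [f1] holds the coefficients of z Phi_n, [f2] those of the reversed polynomial Phi'_n. *)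
pose f1 i := if i is i'.+1 then f i' else 0.
pose f2 i := if (i <= n)%N then f (n - i)%N else 0.
exists (fun i => f1 i - al n * f2 i); split.
  by rewrite /f1 /f2 ltnn mulr0 subr0.
move=> m; rewrite szegoS.
under [RHS]eq_bigr do rewrite scalerBl -scalerA.
rewrite sumrB -scaler_sumr; congr (_ - _ *: _).
  rewrite [RHS]big_ord_recl scale0r add0r IH; apply: eq_bigr => i _.
  congr (_ *: Tz _); rewrite /= /bump /=; lia.
rewrite [RHS]big_ord_recr /= /f2 ltnn scale0r addr0 IH.
rewrite (reindex_inj rev_ord_inj) /=; apply: eq_bigr => i _.
rewrite subSS leq_ord; congr (_ *: _); rewrite -chebTzN; congr (Tz _).
have := leq_ord i; lia.
Qed.

(** The quantity is the squared norm of Phi_n. Orthogonality is a hypothesis here because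
    [szego_orth] at n + 1 divides by this quantity at n: the two facts are proved in alternation. *)
Lemma szego_norm_gt0_of_orth n :
  (forall j : nat, (j < n)%N -> u n j%:Z = 0) -> 0 < u n n%:Z.
Proof.
move=> orth; have [f [fn fE]] := szego_coef n.
(* S is |Phi_n|^2, which dominates (Re Phi_n)^2 = (szego n 0)^2. *)
pose S := \sum_(m < n.+1) f m *: szego n m%:Z.
have LS : L S = u n n%:Z.
  rewrite /S linear_sum big_ord_recr /= fn scale1r big1 ?add0r // => i _.
  by rewrite functionalZ orth ?mulr0.
have C0 : szego n 0 != 0.
  apply: contraTneq (oner_neq0 R) => C0.
  have := congr1 (fun P : {poly R} => P`_n) C0.
  rewrite fE coef_sum coef0 big_ord_recr /= big1 ?add0r.
    rewrite fn subr0 scale1r /chebTz absz_nat.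
    case: n {orth fE S LS C0} fn => [|n] fn; first by rewrite coef1 => /eqP ->.
    by rewrite coef_chebTS => /eqP; rewrite expf_eq0 pnatr_eq0 andbF.
  move=> i _; rewrite coefZ subr0 nth_default ?mulr0 //.
  by rewrite /chebTz absz_nat size_chebT.
rewrite -LS; apply: lt_le_trans (functional_sqr_gt0 Lpos Lorth C0) _.
rewrite -subr_ge0 -raddfB; apply: Lpos => x xI.
have [t ->] : exists t, x = cos t.
  by exists (acos x); rewrite acosK // in_itv /=;
    case/andP: xI => /ltW-> /ltW->.
rewrite hornerD hornerN horner_exp.
have hC (m : int) : (szego n m).[cos t] =
    \sum_(i < n.+1) f i * cos (i%:R * t - m%:~R * t).
  rewrite fE horner_sum; apply: eq_bigr => i _.
  by rewrite hornerZ horner_chebTz rmorphB /= mulrBl.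
have -> : (szego n 0).[cos t] = \sum_(i < n.+1) f i * cos (i%:R * t).
  by rewrite hC; apply: eq_bigr => i _; rewrite mul0r subr0.
have -> : S.[cos t] = (\sum_(i < n.+1) f i * cos (i%:R * t)) ^+ 2
    + (\sum_(i < n.+1) f i * sin (i%:R * t)) ^+ 2.
  rewrite /S horner_sum !expr2 !mulr_suml -big_split; apply: eq_bigr => m _ /=.
  rewrite hornerZ hC !mulr_sumr -big_split; apply: eq_bigr => i _ /=.
  by rewrite -[m%:~R]/(m%:R) cosB; ring.
by rewrite addrAC subrr add0r sqr_ge0.
Qed.

(** At step n + 1, j = 0 is settled by the choice of al_n; for j > 0 both indices j - 1 and n - j
    lie between 0 and n - 1. *)
Lemma szego_orth n (j : nat) : (j < n)%N -> u n j%:Z = 0.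
Proof.
elim: n j => [//|n IH] j; rewrite ltnS => jn.
have En := szego_norm_gt0_of_orth IH.
rewrite szegoS raddfB /= functionalZ.
case: j jn => [_|j jn].
  by rewrite sub0r subr0 /verblunsky divfK ?subrr // gt_eqF.
have -> : j.+1%:Z - 1 = j%:Z by lia.
have -> : n%:Z - j.+1%:Z = (n - j.+1)%N%:Z by lia.
by rewrite !IH ?mulr0 ?subr0 //; lia.
Qed.

Lemma szego_norm_gt0 n : 0 < u n n%:Z.
Proof. exact/szego_norm_gt0_of_orth/szego_orth. Qed.

Lemma verblunskyE n : u n (- 1) = al n * u n n%:Z.
Proof. by rewrite /verblunsky divfK // gt_eqF // szego_norm_gt0. Qed.

Lemma szego_normS n : u n.+1 n.+1%:Z = u n n%:Z * (1 - al n ^+ 2).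
Proof.
rewrite szegoS raddfB /= functionalZ.
have -> : n.+1%:Z - 1 = n%:Z by lia.
have -> : n%:Z - n.+1%:Z = - 1 by lia.
by rewrite verblunskyE; ring.
Qed.

Lemma verblunsky_sqr_lt1 n : al n ^+ 2 < 1.
Proof.
have := szego_norm_gt0 n.+1; rewrite szego_normS pmulr_rgt0 ?subr_gt0 //.
exact: szego_norm_gt0.
Qed.

Lemma szego_normE n : u n n%:Z = L 1 * \prod_(k < n) (1 - al k ^+ 2).
Proof.
elim: n => [|n IH]; first by rewrite big_ord0 mulr1.
by rewrite szego_normS IH big_ord_recr /= mulrA.
Qed.

(** The bound is uniform in j, so the induction closes although the recursion mixes two different
    indices. *)
Lemma szego_le n j (x : R) : -1 <= x <= 1 ->
  `|(szego n j).[x]| <= \prod_(k < n) (1 + `|al k|).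
Proof.
move=> xI; elim: n j => [|n IH] j; first by rewrite big_ord0 chebT_le1.
rewrite szegoS hornerD hornerN hornerZ big_ord_recr /= mulrDr mulr1.
apply: (le_trans (ler_normB _ _)); rewrite lerD //.
by rewrite normrM mulrC ler_wpM2r.
Qed.

(** The passage from the circle back to the interval: multiplication by T_k with k <= m produces the
    indices m + k and m - k, both in [0, 2m], where [szego_orth] applies. *)
Lemma szego_ortho_lower m (Q : {poly R}) : (size Q <= m.+1)%N ->
  L (szego m.*2.+1 m%:Z * Q) = 0.
Proof.
move=> /(poly_basis_expand (@size_chebT R))[c ->].
rewrite mulr_sumr linear_sum big1 // => -[k km] _ /=.
rewrite -scalerAr linearZ /=.
have := congr1 L (szegoM m.*2.+1 m%:Z k); rewrite raddfD raddfMn /=.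
have -> : m%:Z + k%:Z = (m + k)%N%:Z by lia.
have -> : m%:Z - k%:Z = (m - k)%N%:Z by lia.
rewrite !szego_orth ?addr0 //; try lia.
by move/esym/eqP; rewrite mulrn_eq0 /= mulrC => /eqP ->; rewrite mulr0.
Qed.

Lemma szego_top m : exists2 Q : {poly R}, (size Q <= m.+1)%N &
  szego m.*2.+1 m%:Z = Q + chebT R m.+1.
Proof.
have [f [fn ->]] := szego_coef m.*2.+1; rewrite big_ord_recr /= fn scale1r.
exists (\sum_(i < m.*2.+1) f i *: Tz (i%:Z - m%:Z)); last first.
  congr (_ + _); rewrite /chebTz (_ : m.*2.+1%:Z - m%:Z = m.+1%:Z) ?absz_nat //.
  lia.
apply: (leq_trans (size_sum _ _ _)); apply/bigmax_leqP => k _.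
apply: leq_trans (size_scale_leq _ _) _; rewrite size_chebT.
by case: k => k /=; lia.
Qed.

(** By orthogonality one factor may be replaced by its top term T_(m+1); the product formula then
    gives the indices 2m + 1, which is the norm, and -1, which is al times the norm. *)
Lemma szego_sqr m :
  L (szego m.*2.+1 m%:Z ^+ 2) *+ 2
    = u m.*2.+1 m.*2.+1%:Z * (1 + al m.*2.+1).
Proof.
have [Q sQ QE] := szego_top m.
rewrite expr2 {2}QE mulrDr raddfD /= szego_ortho_lower // add0r.
rewrite [_ * chebT _ _]mulrC.
have := congr1 L (szegoM m.*2.+1 m%:Z m.+1); rewrite raddfD raddfMn /= => <-.
have -> : m%:Z + m.+1%:Z = m.*2.+1%:Z by lia.
have -> : m%:Z - m.+1%:Z = - 1 by lia.
by rewrite verblunskyE; ring.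
Qed.

(** Both sides have degree m + 1 and leading coefficient 2^m, and both are orthogonal to lower
    degrees; so their difference has degree at most m and is orthogonal to itself. *)
Lemma szego_orthonormal m :
  szego m.*2.+1 m%:Z = (2 ^+ m / lead_coef (p m.+1)) *: p m.+1.
Proof.
have psz n : size (p n) = n.+1 by case: Lorth.
have g0 : lead_coef (p m.+1) != 0 by rewrite lead_coef_eq0 -size_poly_eq0 psz.
set c := _ / _; pose D := szego m.*2.+1 m%:Z - c *: p m.+1.
have [Q sQ QE] := szego_top m.
have sD : (size D <= m.+1)%N.
  apply/leq_sizeP => j; rewrite leq_eqVlt => /predU1P[<-|nj].
    rewrite coefB coefZ QE coefD coef_chebTS nth_default // add0r.
    have -> : (p m.+1)`_m.+1 = lead_coef (p m.+1) by rewrite lead_coefE psz.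
    by rewrite /c divfK ?subrr.
  rewrite coefB coefZ QE coefD !nth_default ?psz ?size_chebT ?mulr0 ?addr0
    ?subr0 //.
  exact: leq_trans sQ (ltnW nj).
have LD : L (D ^+ 2) = 0.
  rewrite expr2 {1}/D mulrBl raddfB /= szego_ortho_lower // -scalerAl.
  by rewrite functionalZ mulrC mulrC [p _ * _]mulrC (ortho_lower Lorth) //
    mulr0 subr0.
apply/eqP; rewrite -subr_eq0 -/D; apply: contraPT LD => D0.
by apply/eqP; rewrite gt_eqF // (functional_sqr_gt0 Lpos Lorth).
Qed.

(** From [szego_sqr] with 1 + al <= 2. Under regularity the left side decays at most
    subexponentially, hence so does the product. *)
Lemma lead_coef_verblunsky m : 0 < lead_coef (p m.+1) ->
  (2 ^+ m.+1 / lead_coef (p m.+1)) ^+ 2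
    <= 4 * L 1 * \prod_(k < m.*2.+1) (1 - al k ^+ 2).
Proof.
move=> g0; have := szego_sqr m; rewrite szego_orthonormal exprZn functionalZ.
rewrite expr2 [L (_ * _)](proj2 Lorth) eqxx mulr1 => e.
have -> : (2 ^+ m.+1 / lead_coef (p m.+1)) ^+ 2
  = 2 * ((2 ^+ m / lead_coef (p m.+1)) ^+ 2 *+ 2) by rewrite [2 ^+ m.+1]exprS;
    ring.
rewrite -mulrA -szego_normE e.
have := szego_norm_gt0 m.*2.+1; set E := L _ => E0.
have : al m.*2.+1 <= 1.
  have := verblunsky_sqr_lt1 m.*2.+1 => h.
  by rewrite (le_trans (ler_norm _)) // -(@expr_le1 _ 2) // real_normK
    ?num_real // ltW.
by nra.
Qed.

Lemma orthonormal_verblunsky m (x : R) : -1 <= x <= 1 -> 0 < lead_coef (p m.+1)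
  ->
  `|(p m.+1).[x]| <= 2 * (lead_coef (p m.+1) / 2 ^+ m.+1)
     * \prod_(k < m.*2.+1) (1 + `|al k|).
Proof.
move=> xI g0; have := szego_le m.*2.+1 m%:Z xI; rewrite szego_orthonormal.
rewrite hornerZ normrM => h; set g := lead_coef _ in g0 h *.
have c0 : 0 < 2 ^+ m / g by rewrite divr_gt0 // exprn_gt0.
rewrite gtr0_norm // -ler_pdivlMl // in h; apply: le_trans h _.
by rewrite exprS invfM !invfM invrK !mulrA; lra.
Qed.

End SzegoRecursion.

Lemma poly_bounded (R : realType) (Q : {poly R}) :
  exists B, forall x, -1 <= x <= 1 -> `|Q.[x]| <= B.
Proof.
exists (\sum_(i < size Q) `|Q`_i|) => x; rewrite -ler_norml => x1.
rewrite horner_coef (le_trans (ler_norm_sum _ _ _)) // ler_sum // => i _.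
by rewrite normrM normrX ler_piMr // exprn_ile1.
Qed.

(* AM-GM [a <= a^2 / (2 s) + s / 2] turns a bound on the sum of squares into a
   small exponential rate for the product. *)
Lemma prod_1D_le_expR (R : realType) (a : nat -> R) (A s d : R) N :
  0 < A -> 0 < s -> (forall k, a k ^+ 2 < 1) ->
  expR (- d) <= A * \prod_(k < N) (1 - a k ^+ 2) ->
  \prod_(k < N) (1 + `|a k|) <= expR ((d + ln A) / (2 * s) + s / 2 * N%:R).
Proof.
move=> A0 s0 a1 h.
have sumsq : \sum_(k < N) a k ^+ 2 <= d + ln A.
  have : expR (- d) <= expR (ln A - \sum_(k < N) a k ^+ 2).
    apply: (le_trans h); rewrite expRD lnK ?posrE // (ler_wpM2l (ltW A0)) //.
    rewrite -sumrN expR_sum; apply: ler_prod => k _.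
    by rewrite subr_ge0 ltW // expR_ge1Dx.
  by rewrite ler_expR; lra.
have step : \prod_(k < N) (1 + `|a k|) <= expR (\sum_(k < N) `|a k|).
  rewrite expR_sum; apply: ler_prod => k _.
  by rewrite addr_ge0 // expR_ge1Dx.
apply: (le_trans step); rewrite ler_expR.
have : \sum_(k < N) `|a k| <= \sum_(k < N) (a k ^+ 2 / (2 * s) + s / 2).
  apply: ler_sum => k _; rewrite -real_normK ?num_real //; set b := `|a k|.
  rewrite [leLHS](_ : _ = b ^+ 2 / (2 * s) + s / 2 - (b - s) ^+ 2 / (2 * s));
    last by field; rewrite gt_eqF.
  by rewrite gerBl divr_ge0 ?sqr_ge0 // mulr_ge0 // ltW.
move/le_trans; apply; rewrite big_split /= -mulr_suml sumr_const card_ord.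
by rewrite -[s / 2 *+ N]mulr_natr lerD2r ler_wpM2r // invr_ge0 mulr_ge0 // ltW.
Qed.

Lemma regular_lead_coef (R : realType) (p : nat -> {poly R}) (e : R) :
  (forall n, 0 < lead_coef (p n)) -> is_regular p -> 0 < e ->
  \forall n \near \oo, expR (- (e * n%:R)) <= lead_coef (p n) / 2 ^+ n
    <= expR (e * n%:R).
Proof.
move=> g0 reg e0.
have e1 : 1 < expR e by rewrite expR_gt1.
have lo : 2 * expR (- e) < 2 by rewrite gtr_pMr // expR_lt1 oppr_lt0.
have hi : 2 < 2 * expR e by rewrite ltr_pMr.
near=> n.
have n0 : (0 < n)%N by near: n; exists 1%N.
have nR0 : n%:R != 0 :> R by rewrite pnatr_eq0 -lt0n.
have gE : lead_coef (p n) = (lead_coef (p n) `^ n%:R^-1) ^+ n.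
  by rewrite -powR_mulrn ?powR_ge0 // -powRrM mulVf // powRr1 // ltW.
have h1 : 2 * expR (- e) < lead_coef (p n) `^ n%:R^-1.
  by near: n; apply: (cvgr_gt _ reg).
have h2 : lead_coef (p n) `^ n%:R^-1 < 2 * expR e.
  by near: n; apply: (cvgr_lt _ reg).
rewrite gE ler_pdivlMr ?exprn_gt0 // ler_pdivrMr ?exprn_gt0 //.
rewrite -mulNr !expRM_natr -!exprMn ![expR _ * 2]mulrC.
by rewrite !lerXn2r ?nnegrE ?powR_ge0 ?mulr_ge0 ?expR_ge0 // ltW.
Unshelve. all: by end_near. Qed.

Lemma orthonormal_subexponential (R : realType) (L : {scalar {poly R}})
    (p : nat -> {poly R}) (e : R) :
  nonneg_functional L -> orthonormal_for L p ->
  (forall n, 0 < lead_coef (p n)) -> is_regular p -> 0 < e ->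
  exists2 C, 0 < C &
    forall k x, -1 <= x <= 1 -> `|(p k).[x]| <= C * expR (e * k%:R).
Proof.
move=> Lpos Lorth g0 reg e0.
(* Three rates must add up to at most e: e1 from gamma_n / 2^n, e1 / s from the sum of squares, and
   s / 2 for each of the 2m + 1 <= 2n factors. The choice of [e1] makes both e1 and e1 / s at most
   s. *)
pose s := e / 3; have s0 : 0 < s by rewrite divr_gt0.
pose e1 := s * (s / (1 + s)).
have s1 : 0 < s / (1 + s) by rewrite divr_gt0 // addr_gt0.
have e10 : 0 < e1 by rewrite mulr_gt0.
have L10 : 0 < L 1 by rewrite -(expr1n _ 2) (functional_sqr_gt0 Lpos Lorth)
  ?oner_neq0.
pose A := 4 * L 1; have A0 : 0 < A by rewrite mulr_gt0.
have [N _ hN] := regular_lead_coef g0 reg e10.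
(* The finitely many k <= N not covered by the asymptotic bounds are absorbed into the constant. *)
pose B k := sval (cid (poly_bounded (p k))).
have BP k x : -1 <= x <= 1 -> `|(p k).[x]| <= B k.
  by rewrite /B; case: cid => /= b; apply.
have B0 k : 0 <= B k by apply: le_trans (BP k 0 _); rewrite ?lerN10 ?ler01.
pose C1 := 2 * expR (ln A / (2 * s)).
exists (C1 + \sum_(k < N.+1) B k).
  by rewrite ltr_wpDr ?sumr_ge0 // mulr_gt0 // expR_gt0.
move=> k x xI; have e_k : 0 <= e * k%:R by rewrite mulr_ge0 // ltW.
have E1 : 1 <= expR (e * k%:R) by rewrite -[leLHS]expR0 ler_expR.
have C10 : 0 <= C1 by rewrite /C1 mulr_ge0 ?expR_ge0.
have S0 : 0 <= \sum_(i < N.+1) B i by apply: sumr_ge0.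
have [kN|Nk] := ltnP k N.+1.
  apply: le_trans (BP k x xI) _.
  apply: (@le_trans _ _ (C1 + \sum_(i < N.+1) B i)).
    by rewrite (bigD1 (Ordinal kN)) //= addrCA lerDl addr_ge0 // sumr_ge0.
  by rewrite ler_peMr // addr_ge0.
case: k Nk e_k E1 => // m Nm e_k E1; have /andP[lo hi] := hN m.+1 (ltnW Nm).
set n := m.+1 in lo hi e_k E1 *.
apply: le_trans (orthonormal_verblunsky Lpos Lorth xI (g0 _)) _.
have := lead_coef_verblunsky Lpos Lorth (g0 m.+1); rewrite -/A -/n => up.
have cE : 2 ^+ n / lead_coef (p n) = (lead_coef (p n) / 2 ^+ n)^-1.
  by rewrite invf_div.
have c_lo : expR (- (2 * e1 * n%:R)) <= (2 ^+ n / lead_coef (p n)) ^+ 2.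
  rewrite cE -mulrA -mulrN expRM_natl lerXn2r ?nnegrE ?expR_ge0 ?invr_ge0 //.
    by rewrite divr_ge0 // ?exprn_ge0 // ltW.
  by rewrite expRN lef_pV2 ?posrE ?expR_gt0 // divr_gt0 // ?exprn_gt0 //.
have {}up := prod_1D_le_expR A0 s0 (verblunsky_sqr_lt1 Lpos Lorth)
  (le_trans c_lo up).
apply: (@le_trans _ _ (2 * expR (e1 * n%:R) *
    expR ((2 * e1 * n%:R + ln A) / (2 * s) + s / 2 * m.*2.+1%:R))).
  apply: ler_pM => //; last by rewrite ler_wpM2l.
    by rewrite mulr_ge0 // divr_ge0 ?exprn_ge0 // ltW.
  by apply: prodr_ge0 => i _; rewrite addr_ge0.
apply: (@le_trans _ _ (C1 * expR (e * n%:R))); last first.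
  by rewrite ler_wpM2r ?expR_ge0 // lerDl.
rewrite /C1 -!(mulrA 2) -!expRD ler_wpM2l // ler_expR.
have -> : (2 * (e1 * n%:R) + ln A) / (2 * s) = s / (1 + s) * n%:R + ln A / (2 *
  s).
  by rewrite /e1; field; rewrite !gt_eqF // addr_gt0.
have m2 : m.*2.+1%:R <= 2 * n%:R :> R.
  by rewrite -(natrM R 2 n) ler_nat mul2n doubleS.
have ss : s / (1 + s) <= s.
  by rewrite ler_pdivrMr ?addr_gt0 // ler_peMr ?(ltW s0) // lerDl (ltW s0).
have e1s : e1 <= s.
  by rewrite /e1 ler_piMr ?(ltW s0) // ler_pdivrMr ?addr_gt0 // mul1r lerDr.
have eE : e = 3 * s by rewrite /s mulrC divfK.
have h1 := ler_wpM2r (ler0n R n) ss; have h2 := ler_wpM2r (ler0n R n) e1s.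
have h3 : s / 2 * m.*2.+1%:R <= s * n%:R.
  rewrite -mulrA (ler_wpM2l (ltW s0)) // mulrC ler_pdivrMr //.
  by rewrite [leRHS]mulrC.
by rewrite eE; lra.
Unshelve. all: by end_near. Qed.

(** * The Chebyshev weight of the second kind *)

Section WeightedIntegral.
Variables (R : realType) (m : {measure set (measurableTypeR R) -> \bar R}).
Variable v : R -> R.
Local Notation D := (`]-1, 1[%classic : set R).

(** Used with v = 1 for mu, and with Lebesgue measure and v = sqrt(1 - x^2) for the reference
    measure. *)
Definition weighted_integral (P : {poly R}) : R :=
  \int[m]_(x in D) (P.[x] * v x).

Hypothesis mD : (m D < +oo)%E.
Hypothesis mv : measurable_fun (D : set (measurableTypeR R)) v.
Hypothesis bv : exists B, forall x, -1 < x < 1 -> `|v x| <= B.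

Lemma measurable_horner (A : set (measurableTypeR R)) (P : {poly R}) :
  measurable_fun A (fun x => P.[x] : R).
Proof.
apply: (measurable_funS measurableT) => //.
by apply: continuous_measurable_fun => x; exact: continuous_horner.
Qed.

Lemma measurable_weighted (P : {poly R}) :
  measurable_fun (D : set (measurableTypeR R)) (fun x => P.[x] * v x).
Proof. by apply: measurable_funM => //; exact: measurable_horner. Qed.

Lemma integrable_weighted (P : {poly R}) :
  m.-integrable (D : set (measurableTypeR R)) (EFin \o (fun x => P.[x] * v x)).
Proof.
apply: measurable_bounded_integrable => //; first exact: measurable_weighted.
have [B BP] := poly_bounded P; have [C CP] := bv.
exists (B * C); split; first exact: num_real.
move=> M BM x /=; rewrite in_itv /= => /[dup] xD /andP[x0 x1].
apply: ltW; apply: le_lt_trans BM; rewrite normrM ler_pM // ?CP //.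
by rewrite BP // !ltW.
Qed.

Lemma weighted_integral_scalar : scalar weighted_integral.
Proof.
move=> a P Q; rewrite /weighted_integral.
under eq_Rintegral do rewrite hornerD hornerZ mulrDl -mulrA.
rewrite RintegralD //; last 2 first.
- by have := integrable_weighted (a *: P); apply: eq_integrable => // x _ /=;
    rewrite hornerZ mulrA.
- exact: integrable_weighted.
by rewrite RintegralZl //; exact: integrable_weighted.
Qed.

Lemma weighted_functional : (forall x, -1 < x < 1 -> 0 <= v x) ->
  exists2 L : {scalar {poly R}},
    (forall P, L P = weighted_integral P) & nonneg_functional L.
Proof.
move=> v0; pose L : {scalar {poly R}} :=
  HB.pack weighted_integral (GRing.isLinear.Build R {poly R} R *%R
    weighted_integral weighted_integral_scalar).
exists L => // P P0; apply: Rintegral_ge0 => x /=; rewrite in_itv /= => xD.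
by rewrite mulr_ge0 ?P0 ?v0.
Qed.

End WeightedIntegral.

(** * Chebyshev polynomials of the second kind and their orthogonality *)

Section ChebyshevSecondKind.
Variable R : realType.
Local Notation leb := (@lebesgue_measure R).

(** The recursion is the addition formula for sin((n+2)t) divided by sin t; it gives the bound |U_n|
    <= n + 1 at once. *)
Fixpoint chebU (n : nat) : {poly R} :=
  if n is m.+1 then 'X * chebU m + chebT R m.+1 else 1.

Lemma chebUS n : chebU n.+1 = 'X * chebU n + chebT R n.+1.
Proof. by []. Qed.

Lemma horner_chebU n (t : R) : (chebU n).[cos t] * sin t = sin (n.+1%:R * t).
Proof.
elim: n => [|n IH]; first by rewrite hornerE !mul1r.
rewrite chebUS hornerD hornerM hornerX horner_chebT mulrDl -mulrA IH.
by rewrite -[n.+2%:R]natr1 mulrDl mul1r sinD addrC mulrC [cos t * _]mulrC addrC.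
Qed.

Lemma size_chebU n : size (chebU n) = n.+1.
Proof.
suff [ss cc] : (size (chebU n) <= n.+1)%N /\ (chebU n)`_n = 2 ^+ n.
  apply/eqP; rewrite eqn_leq ss ltnNge; apply/negP => /(nth_default 0) e.
  by move: cc; rewrite e => /esym/eqP; rewrite expf_eq0 pnatr_eq0 andbF.
elim: n => [|n [IHs IHc]]; first by rewrite size_poly1 coef1.
rewrite chebUS coefD coefXM /= IHc coef_chebTS exprS; split; last by ring.
apply: leq_trans (size_polyD _ _) _; rewrite size_chebT geq_max leqnn andbT.
by apply: leq_trans (size_polyMleq _ _) _; rewrite size_polyX.
Qed.

Lemma chebU_le n (x : R) : -1 <= x <= 1 -> `|(chebU n).[x]| <= n.+1%:R.
Proof.
move=> xI; elim: n => [|n IH]; first by rewrite hornerE normr1.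
rewrite chebUS hornerD hornerM hornerX (le_trans (ler_normD _ _)) //.
rewrite -[n.+2%:R]natr1 lerD ?chebT_le1 // normrM (le_trans _ IH) //.
by rewrite ler_piMl // ler_norml.
Qed.

Lemma sin_natpi n : sin (n%:R * pi) = 0 :> R.
Proof.
elim: n => [|n IH]; first by rewrite mul0r sin0.
by rewrite -natr1 mulrDl mul1r sinDpi IH oppr0.
Qed.

Lemma integral_cos_natmul n :
  \int[leb]_(t in `[0, pi]) cos (n%:R * t) = if n == 0%N then pi else 0.
Proof.
case: n => [|n] /=.
  under eq_Rintegral do rewrite mul0r cos0.
  rewrite Rintegral_cst //= lebesgue_measure_itv /= lte_fin pi_gt0 /=.
  by rewrite oppr0 addr0 mul1r.
pose F (t : R) : R := sin (n.+1%:R * t) / n.+1%:R.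
have n0 : n.+1%:R != 0 :> R by [].
have dF (t : R) : is_derive t 1 F (cos (n.+1%:R * t)).
  rewrite /F; apply: is_derive_eq; rewrite !scaler0 add0r /GRing.scale /=.
  by field.
have cF : continuous F.
  by move=> t; apply/differentiable_continuous/derivable1_diffP/ex_derive.
rewrite /Rintegral (@continuous_FTC2 _ (fun t => cos (n.+1%:R * t)) F) ?pi_gt0
  //.
- by rewrite /F /= mulr0 sin0 mul0r subr0 sin_natpi mul0r.
- apply: continuous_subspaceT => t.
  apply: continuous_comp; last exact: continuous_cos.
  exact: mulrl_continuous.
- split; first by move=> t _; apply: ex_derive.
  + exact/cvg_at_right_filter/cF.
  + exact/cvg_at_left_filter/cF.
- by move=> t _; rewrite derive1E derive_val.
Qed.

Definition cheb_weight (x : R) : R := Num.sqrt (1 - x ^+ 2).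

Lemma continuous_cheb_weight : continuous cheb_weight.
Proof.
move=> x; apply: continuous_comp; last exact: sqrt_continuous.
by apply: cvgB; [exact: cvg_cst | exact: exprn_continuous].
Qed.

Lemma integral_cheb_subst (P : {poly R}) :
  weighted_integral leb cheb_weight P =
  \int[leb]_(t in `[0, pi]) (P.[cos t] * sin t * sin t).
Proof.
have mh (A : set (measurableTypeR R)) : measurable_fun A (EFin \o (fun x =>
  P.[x] * cheb_weight x)).
  apply/measurable_EFinP; apply: measurable_funM;
    first exact: measurable_horner.
  apply: (measurable_funS measurableT) => //.
  exact: continuous_measurable_fun continuous_cheb_weight.
rewrite /weighted_integral /Rintegral; congr fine.
(* The endpoints are null, and the substitution x = cos t is made on the closed interval. One factor
   sin t comes from the weight, the other from dx. *)
rewrite -[LHS](@integral_itv_bndoo R (-1) 1 _ true false); last exact: mh.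
have pi0 := pi_ge0 R.
have dcos (t : R) : is_derive t 1 cos (- sin t) by exact: is_derive_cos.
have cosd : derive1 cos = (fun t : R => - sin t).
  by apply/funext => t; rewrite derive1E derive_val.
rewrite -[-1]cospi -cos0.
have cs : continuous (derive1 (cos : R -> R)).
  by rewrite cosd => t; apply: cvgN; exact: continuous_sin.
rewrite integration_by_substitution_decreasing //.
- apply: eq_integral => t; rewrite inE /= in_itv /= => /andP[t0 tpi].
  congr (EFin _); rewrite cosd /cheb_weight.
  change (P.[cos t] * Num.sqrt (1 - cos t ^+ 2) * - (- sin t) = P.[cos t] * sin
    t * sin t).
  rewrite opprK -sin2cos2 sqrtr_sqr.
  by rewrite ger0_norm // sin_ge0_pi // t0.
- by move=> x y xI yI; rewrite ltr_cos.
- by apply/cvg_ex; exists (derive1 cos 0); apply/cvg_at_right_filter/cs.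
- by apply/cvg_ex; exists (derive1 cos pi); apply/cvg_at_left_filter/cs.
- split; first by move=> t _; apply: ex_derive.
  + exact/cvg_at_right_filter/continuous_cos.
  + exact/cvg_at_left_filter/continuous_cos.
- apply: continuous_subspaceT => x; apply: cvgM; first exact: continuous_horner.
  exact: continuous_cheb_weight.
Qed.

Lemma chebU_orth j k :
  weighted_integral leb cheb_weight (chebU j * chebU k)
    = if j == k then pi / 2 else 0.
Proof.
rewrite integral_cheb_subst.
have int_cos n : leb.-integrable `[0, pi]
    (EFin \o (fun t => cos (n%:R * t))).
  apply: continuous_compact_integrable; first exact: segment_compact.
  apply: continuous_subspaceT => t.
  by apply: continuous_comp; [exact: mulrl_continuous|exact: continuous_cos].
pose d := ((j - k) + (k - j))%N.
have E t : (chebU j * chebU k).[cos t] * sin t * sin t =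
    2^-1 * (cos (d%:R * t) - cos ((j + k).+2%:R * t)).
  rewrite hornerM -mulrA [X in X * _ = _]mulrC -mulrA [_ * (sin t * _)]mulrA.
  rewrite horner_chebU mulrCA horner_chebU.
  have -> : (j + k).+2%:R * t = j.+1%:R * t + k.+1%:R * t.
    by rewrite -mulrDl -natrD addSn addnS.
  have -> : cos (d%:R * t) = cos (j.+1%:R * t - k.+1%:R * t).
    rewrite -mulrBl; case: (leqP k j) => jk.
      by rewrite /d (eqP jk) addn0 -natrB // subSS.
    rewrite -[in RHS]opprB mulNr cosN -natrB ?subSS; last exact: ltnW.
    by rewrite /d (eqP (ltnW jk)) add0n.
  by rewrite cosB cosD; field.
under eq_Rintegral do rewrite E.
rewrite RintegralZl //; last first.
  exact: (integrableB _ (int_cos d) (int_cos (j + k).+2)).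
rewrite RintegralB // !integral_cos_natmul subr0.
have -> : (d == 0)%N = (j == k) by rewrite /d addn_eq0 !subn_eq0 -eqn_leq.
by case: ifP; rewrite ?mulr0 // mulrC.
Qed.

End ChebyshevSecondKind.

(** * Scaling limit of the Chebyshev kernel *)

Section SincAsymptotics.
Variable R : realType.

(** Its continuity at 0 absorbs the diagonal case a = b, so limits are stated with it throughout. *)
Definition sinc (u : R) : R := if u == 0 then 1 else sin u / u.

Lemma sin_sinc (u : R) : sin u = u * sinc u.
Proof.
by rewrite /sinc; case: eqP => [->|/eqP u0];
  rewrite ?sin0 ?mul0r // mulrC divfK.
Qed.

Lemma sincN (u : R) : sinc (- u) = sinc u.
Proof. by rewrite /sinc oppr_eq0 sinN invrN mulrNN. Qed.

Lemma sine_kernelE (a b : R) : sine_kernel a b = sinc (pi * (a - b)).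
Proof. by rewrite /sine_kernel /sinc mulf_eq0 (gt_eqF (pi_gt0 R)) subr_eq0. Qed.

Lemma cvg_near_eq {I : Type} {F : set_system I} {FF : Filter F} (f g : I -> R)
  (l : R) :
  (\forall i \near F, f i = g i) -> f i @[i --> F] --> l -> g i @[i --> F] -->
    l.
Proof. by move=> fg; apply: cvg_trans; exact: near_eq_cvg. Qed.

Lemma continuous_sinc : continuous sinc.
Proof.
move=> u; have [->|u0] := eqVneq u 0.
  apply/continuous_withinNx; rewrite {2}/sinc eqxx.
  have d0 : derivable (sin : R -> R) 0 1 by exact: ex_derive.
  have : h^-1 *: ((sin \o shift 0) (h *: 1) - sin 0) @[h --> 0^'] --> (1 : R).
    by rewrite -[X in _ --> X](@cos0 R) -(@derive_val _ _ _ _ _ _ _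
      (is_derive_sin 0)); exact: d0.
  apply: cvg_near_eq; near=> h; rewrite /= /sinc ifF; last first.
    by apply/negbTE; near: h; exact: nbhs_dnbhs_neq.
  by rewrite addr0 sin0 subr0 /GRing.scale /= mulr1 mulrC.
have s_div : sin v / v @[v --> u] --> sin u / u.
  by apply: cvgM; [exact: continuous_sin|apply: cvgV => //; exact: cvg_id].
rewrite /continuous_at {2}/sinc (negbTE u0).
apply: cvg_near_eq s_div; near=> v; rewrite /sinc ifF //.
by apply/negbTE; near: v; exact: open_neq.
Unshelve. all: by end_near. Qed.

Lemma sum_cos n (t : R) :
  (\sum_(k < n) cos (k.+1%:R * t)) * sin (t / 2)
    = cos (n.+1%:R * t / 2) * sin (n%:R * t / 2).
Proof.
elim: n => [|n IH]; first by rewrite big_ord0 !mul0r sin0 mulr0.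
rewrite big_ord_recr /= mulrDl IH.
have e1 : n.+1%:R * t / 2 = n%:R * t / 2 + t / 2 by rewrite -natr1; ring.
have e2 : n.+2%:R * t / 2 = n%:R * t / 2 + t / 2 + t / 2 by rewrite -!natr1;
  ring.
have e3 : n.+1%:R * t = (n%:R * t / 2 + t / 2) + (n%:R * t / 2 + t / 2).
  by rewrite -natr1; field.
have e4 : n%:R * t / 2 = (n%:R * t / 2 + t / 2) - t / 2 by rewrite addrK.
rewrite e1 e2 e3 [in sin (n%:R * _ / _)]e4.
set c := n%:R * t / 2 + t / 2; set b := t / 2.
by rewrite sinB !cosD; ring.
Qed.

(** The Dirichlet sum divided by t / 2, in a form that stays valid and informative at t = 0. *)
Lemma sum_cos_sinc n (t : R) :
  (\sum_(k < n) cos (k.+1%:R * t)) * sinc (t / 2)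
    = n%:R * (cos (n.+1%:R * t / 2) * sinc (n%:R * t / 2)).
Proof.
have [->|t0] := eqVneq t 0.
  rewrite !(mulr0, mul0r) cos0 /sinc eqxx !mulr1.
  under eq_bigr do rewrite mulr0 cos0.
  by rewrite sumr_const card_ord.
have := sum_cos n t; rewrite !sin_sinc => h.
have t2 : t / 2 != 0 by rewrite mulf_neq0.
apply: (mulfI t2); rewrite mulrCA {}h.
by ring.
Qed.

Section Filters.
Context {I : Type} {F : set_system I} {FF : Filter F}.
Variable N : I -> nat.
Hypothesis Noo : forall k, \forall i \near F, (k <= N i)%N.

Lemma inv_cvg0 : (N i)%:R^-1 @[i --> F] --> (0 : R).
Proof.
apply/cvgrPdist_le => e e0; have := Noo (Num.truncn e^-1).+1.
apply: filterS => i Ni; rewrite sub0r normrN ger0_norm ?invr_ge0 //.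
rewrite invf_ple ?posrE //; last by rewrite ltr0n (leq_trans _ Ni).
apply: le_trans (ltW (truncnS_gt _)) _; by rewrite ler_nat.
Qed.

Lemma mean_cos_cvg (T : I -> R) (sg : R) : T i @[i --> F] --> 0 ->
  (N i)%:R * T i @[i --> F] --> sg ->
  (\sum_(k < N i) cos (k.+1%:R * T i)) / (N i)%:R @[i --> F] --> sinc sg.
Proof.
move=> T0 NT.
have T2 : sinc (T i / 2) @[i --> F] --> (1 : R).
  have s1 : sinc (0 / 2) = 1 :> R by rewrite mul0r /sinc eqxx.
  rewrite -[X in _ --> X]s1.
  apply: continuous_cvg; first exact: continuous_sinc.
  by apply: cvgM => //; exact: cvg_cst.
have NT2 : (N i)%:R * T i / 2 @[i --> F] --> sg / 2.
  by apply: cvgM => //; exact: cvg_cst.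
(* The double angle formula; the terms [0 / 2] and [/ 1] are the limits of T / 2 and sinc (T / 2),
   kept to match the convergence factor by factor. *)
have sE : sinc sg = cos (sg / 2 + 0 / 2) * sinc (sg / 2) / 1.
  rewrite mul0r addr0 divr1; rewrite {1}/sinc; case: eqP => [->|/eqP s0].
    by rewrite mul0r cos0 /sinc eqxx mulr1.
  have -> : sin sg = 2 * (sin (sg / 2) * cos (sg / 2)).
    by rewrite {1}(splitr sg) sinD; ring.
  by rewrite sin_sinc; field.
rewrite sE.
apply: (@cvg_near_eq _ _ _ (fun i => cos ((N i)%:R * T i / 2 + T i / 2)
   * sinc ((N i)%:R * T i / 2) / sinc (T i / 2))).
  have s1 : \forall i \near F, 0 < sinc (T i / 2) by apply: (cvgr_gt _ T2).
  near=> i.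
  have Ni0 : (N i)%:R != 0 :> R.
    by rewrite pnatr_eq0 -lt0n; near: i; exact: Noo.
  have si0 : sinc (T i / 2) != 0 by rewrite gt_eqF //; near: i.
  apply: (mulIf si0); rewrite divfK // [RHS]mulrAC sum_cos_sinc [RHS]mulrAC
    mulfV // mul1r.
  by rewrite -[(N i).+1%:R]natr1 !mulrDl mul1r.
apply: cvgM; last by apply: cvgV => //; exact: oner_neq0.
apply: cvgM; apply: continuous_cvg;
  [exact: continuous_cos| |exact: continuous_sinc|done].
by apply: cvgD => //; apply: cvgM => //; exact: cvg_cst.
Unshelve. all: by end_near. Qed.

(** Away from multiples of 2 pi the Dirichlet sum is bounded by 1 / |sin (T / 2)|, whatever its
    length. *)
Lemma mean_cos_cvg0 (T : I -> R) (t0 : R) : T i @[i --> F] --> t0 ->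
  sin (t0 / 2) != 0 ->
  (\sum_(k < N i) cos (k.+1%:R * T i)) / (N i)%:R @[i --> F] --> (0 : R).
Proof.
move=> Tt0 s0.
have sT : `|sin (T i / 2)| @[i --> F] --> `|sin (t0 / 2)|.
  apply: cvg_norm; apply: continuous_cvg; first exact: continuous_sin.
  by apply: cvgM => //; exact: cvg_cst.
have s0' : `|sin (t0 / 2)| != 0 by rewrite normr_eq0.
have b0 : (N i)%:R^-1 / `|sin (T i / 2)| @[i --> F] --> (0 : R).
  by rewrite -(mul0r `|sin (t0 / 2)|^-1); apply: cvgM;
    [exact: inv_cvg0|exact: cvgV].
apply: norm_cvg0; apply: squeeze_cvgr (cvg_cst 0) b0.
have sp : \forall i \near F, 0 < `|sin (T i / 2)|.
  by apply: (cvgr_gt _ sT); rewrite normr_gt0.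
near=> i; rewrite normr_ge0 /= normrM [leRHS]mulrC.
rewrite [`|_^-1|]ger0_norm ?invr_ge0 // ler_wpM2r ?invr_ge0 //.
have si : 0 < `|sin (T i / 2)| by near: i.
rewrite -[leRHS]mul1r ler_pdivlMr // -normrM sum_cos normrM.
by rewrite mulr_ile1 // ler_norml ?cos_geN1 ?cos_le1 ?sin_geN1 ?sin_le1.
Unshelve. all: by end_near. Qed.

End Filters.
End SincAsymptotics.

(** * The reproducing kernel of the Chebyshev weight and its limit *)

Section ChebyshevKernel.
Variable R : realType.

Definition chebu (n : nat) : {poly R} := Num.sqrt (2 / pi) *: chebU R n.

Let c20 : 0 < 2 / pi :> R. Proof. by rewrite divr_gt0 // pi_gt0. Qed.

Let sqr_c2 : Num.sqrt (2 / pi) * Num.sqrt (2 / pi) = 2 / pi :> R.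
Proof. by rewrite -expr2 sqr_sqrtr // ltW. Qed.

Lemma chebu_orthonormal (L : {scalar {poly R}}) :
  (forall P, L P = weighted_integral lebesgue_measure (@cheb_weight R) P) ->
  orthonormal_for L chebu.
Proof.
move=> LE; split=> [n|j k].
  by rewrite size_scale ?size_chebU // gt_eqF // sqrtr_gt0.
rewrite /chebu -scalerAl -scalerAr scalerA functionalZ LE chebU_orth sqr_c2.
case: eqP => _; last by rewrite mulr0.
have p0 : pi != 0 :> R by rewrite gt_eqF ?pi_gt0.
by rewrite mulr1n; move: (@pi R) p0 => q q0; field.
Qed.

Lemma kernel_chebuE n (x y : R) : kernel_K chebu n x y =
  2 / pi * \sum_(k < n) (chebU R k).[x] * (chebU R k).[y].
Proof.
rewrite mulr_sumr; apply: eq_bigr => k _.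
by rewrite !hornerZ mulrACA sqr_c2.
Qed.

(** Crude on purpose: any polynomial bound is beaten by the geometric decay of the bump power. *)
Lemma kernel_chebu_le n (x y : R) : -1 <= x <= 1 -> -1 <= y <= 1 ->
  `|kernel_K chebu n x y| <= n%:R ^+ 3.
Proof.
move=> xI yI; rewrite kernel_chebuE normrM (gtr0_norm c20).
apply: (@le_trans _ _ (1 * (n%:R ^+ 2 *+ n))); last first.
  by rewrite mul1r -[_ *+ n]mulr_natr -exprSr.
apply: ler_pM => //; first exact: ltW.
  by rewrite ler_pdivrMr ?pi_gt0 // mul1r pi_ge2.
apply: le_trans (ler_norm_sum _ _ _) _.
rewrite -[X in _ *+ X](card_ord n) -sumr_const; apply: ler_sum => k _.
rewrite normrM expr2 ler_pM //.
  by apply: le_trans (chebU_le k xI) _; rewrite ler_nat.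
by apply: le_trans (chebU_le k yI) _; rewrite ler_nat.
Qed.

(** The sum in a - b produces the sine kernel; the sum in a + b stays bounded when a and b are near
    an interior angle. *)
Lemma kernel_chebu_cos n (a b : R) :
  kernel_K chebu n (cos a) (cos b) * (sin a * sin b) =
  (\sum_(k < n) cos (k.+1%:R * (a - b)) - \sum_(k < n) cos (k.+1%:R * (a + b)))
  / pi.
Proof.
rewrite kernel_chebuE -sumrB; set S := \sum_(k < n) _ * _.
have -> : \sum_(k < n) (cos (k.+1%:R * (a - b)) - cos (k.+1%:R * (a + b)))
    = 2 * (S * (sin a * sin b)).
  rewrite mulr_suml mulr_sumr; apply: eq_bigr => k _.
  rewrite mulrACA !horner_chebU mulrBr mulrDr cosB cosD; ring.
by move: (@pi R) => q; ring.
Qed.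

Lemma cheb_weight_cos (a : R) : 0 <= a <= pi -> cheb_weight (cos a) = sin a.
Proof.
by move=> aI; rewrite /cheb_weight -sin2cos2 sqrtr_sqr ger0_norm ?sin_ge0_pi.
Qed.

Section Filters.
Context {I : Type} {F : set_system I} {FF : Filter F}.
Variables (N : I -> nat) (X Y : I -> R) (x0 s : R).
Hypothesis Noo : forall k, \forall i \near F, (k <= N i)%N.
Hypothesis x0I : -1 < x0 < 1.
Hypothesis Xx0 : X i @[i --> F] --> x0.
Hypothesis Yx0 : Y i @[i --> F] --> x0.
Hypothesis NXY : (N i)%:R * (X i - Y i) @[i --> F] --> s.

Lemma kernel_chebu_cvg : kernel_K chebu (N i) (X i) (Y i) / (N i)%:R
  @[i --> F] --> sinc (s / cheb_weight x0) / (pi * cheb_weight x0 ^+ 2).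
Proof.
have /andP[x0l x0r] := x0I.
pose th := acos x0; pose a i := acos (X i); pose b i := acos (Y i).
have thI : 0 < th < pi by rewrite acos_gt0 ?acos_ltpi // ?ltW ?x0l ?x0r // ltW.
have cth : cos th = x0 by rewrite acosK // in_itv /= !ltW.
have w0 : cheb_weight x0 = sin th.
  by rewrite -cth cheb_weight_cos //; case/andP: thI => /ltW-> /ltW->.
have sth0 : 0 < sin th by rewrite sin_gt0_pi.
have a_th : a i @[i --> F] --> th.
  by apply: continuous_cvg => //; exact: continuous_acos.
have b_th : b i @[i --> F] --> th.
  by apply: continuous_cvg => //; exact: continuous_acos.
have XI : \forall i \near F, -1 <= X i <= 1.
  have h1 := cvgr_gt _ Xx0 _ x0l; have h2 := cvgr_lt _ Xx0 _ x0r.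
  by near=> i; apply/andP; split; apply: ltW; near: i; [exact: h1|exact: h2].
have YI : \forall i \near F, -1 <= Y i <= 1.
  have h1 := cvgr_gt _ Yx0 _ x0l; have h2 := cvgr_lt _ Yx0 _ x0r.
  by near=> i; apply/andP; split; apply: ltW; near: i; [exact: h1|exact: h2].
have ab0 : a i - b i @[i --> F] --> 0 by rewrite -(subrr th); exact: cvgB.
have ab2 : a i + b i @[i --> F] --> th + th by exact: cvgD.
have th2 : (th + th) / 2 = th by rewrite mulrDl -splitr.
have sc : sinc ((a i - b i) / 2) @[i --> F] --> (1 : R).
  have s1 : sinc (0 / 2) = 1 :> R by rewrite mul0r /sinc eqxx.
  rewrite -[X in _ --> X]s1; apply: continuous_cvg;
    first exact: continuous_sinc.
  by apply: cvgM => //; exact: cvg_cst.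
have sp : sin ((a i + b i) / 2) @[i --> F] --> sin th.
  rewrite -[X in sin X]th2; apply: continuous_cvg; first exact: continuous_sin.
  by apply: cvgM => //; exact: cvg_cst.
(* From X - Y = -2 sin((a+b)/2) sin((a-b)/2); the factor 1 is the limit of sinc ((a-b)/2). *)
have Nab : (N i)%:R * (a i - b i) @[i --> F] --> - s / (sin th * 1).
  have sp0 := cvgr_gt _ sp _ sth0; have sc0 := cvgr_gt _ sc _ ltr01.
  apply: (@cvg_near_eq _ _ _ _ (fun i => - ((N i)%:R * (X i - Y i)) /
      (sin ((a i + b i) / 2) * sinc ((a i - b i) / 2)))); last first.
    apply: cvgM; first exact: cvgN.
    by apply: cvgV; [rewrite mulr1 gt_eqF|exact: cvgM].
  near=> i.
  have q0 : sin ((a i + b i) / 2) * sinc ((a i - b i) / 2) != 0.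
    by rewrite gt_eqF // mulr_gt0 //; near: i; [exact: sp0|exact: sc0].
  apply: (mulIf q0); rewrite divfK //.
  have -> : X i = cos ((a i + b i) / 2 + (a i - b i) / 2).
    rewrite -mulrDl addrACA subrr addr0 mulrDl -splitr acosK // in_itv /=.
    by near: i.
  have -> : Y i = cos ((a i + b i) / 2 - (a i - b i) / 2).
    rewrite -mulrBl opprB addrC addrA subrK mulrDl -splitr acosK // in_itv /=.
    by near: i.
  by rewrite cosB cosD [sin ((a i - b i) / 2)]sin_sinc; field.
have /(_ FF) A1 := mean_cos_cvg Noo ab0 Nab.
have A2 : (\sum_(k < N i) cos (k.+1%:R * (a i + b i))) / (N i)%:R @[i --> F]
  --> (0 : R).
  by apply: mean_cos_cvg0 ab2 _ => //; rewrite th2 gt_eqF.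
have sa : sin (a i) @[i --> F] --> sin th by apply: continuous_cvg => //;
  exact: continuous_sin.
have sb : sin (b i) @[i --> F] --> sin th by apply: continuous_cvg => //;
  exact: continuous_sin.
have sa0 := cvgr_gt _ sa _ sth0; have sb0 := cvgr_gt _ sb _ sth0.
have -> : sinc (s / cheb_weight x0) / (pi * cheb_weight x0 ^+ 2) =
   (sinc (- s / (sin th * 1)) - 0) / pi / (sin th * sin th).
  have p0 : pi != 0 :> R by rewrite gt_eqF ?pi_gt0.
  have s0 : sin th != 0 by rewrite gt_eqF.
  by rewrite w0 mulr1 mulNr sincN subr0; move: (@pi R) p0 => q q0; field;
    apply/andP.
apply: (@cvg_near_eq _ _ _ _ (fun i =>
   ((\sum_(k < N i) cos (k.+1%:R * (a i - b i))) / (N i)%:R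
    - (\sum_(k < N i) cos (k.+1%:R * (a i + b i))) / (N i)%:R) / pi
   / (sin (a i) * sin (b i)))); last first.
  apply: cvgM; last by apply: cvgV; [rewrite mulf_neq0 // gt_eqF|exact: cvgM].
  by apply: cvgM; [exact: cvgB | exact: cvg_cst].
near=> i.
have q0 : sin (a i) * sin (b i) != 0.
  by rewrite gt_eqF // mulr_gt0 //; near: i; [exact: sa0|exact: sb0].
apply: (mulIf q0); rewrite divfK //.
have -> : X i = cos (a i) by rewrite acosK // in_itv /=; near: i.
have -> : Y i = cos (b i) by rewrite acosK // in_itv /=; near: i.
by rewrite [RHS]mulrAC kernel_chebu_cos -mulrBl mulrAC.
Unshelve. all: by end_near. Qed.

End Filters.
End ChebyshevKernel.

(** * Comparison of the measures near a point of continuity *)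

(* m2 plus the restriction of m1 to the complement of J dominates m1 on every
   set, which is what ge0_le_measure_integral asks for. *)
Lemma ge0_le_measure_integral_on d (T : measurableType d) (R : realType)
    (m1 m2 : {measure set T -> \bar R}) (J : set T) (f : T -> \bar R) :
  measurable J -> (forall S, measurable S -> S `<=` J -> (m1 S <= m2 S)%E) ->
  (forall x, J x -> (0 <= f x)%E) -> measurable_fun J f ->
  (\int[m1]_(x in J) f x <= \int[m2]_(x in J) f x)%E.
Proof.
move=> mJ m12 f0 mf; have mJC : measurable (~` J) by exact: measurableC.
pose m3 := measure_add m2 (mrestr m1 mJC).
have fJ0 x : (0 <= (f \_ J) x)%E by rewrite patchE;
  case: ifPn => // /set_mem/f0.
have mfJ : measurable_fun setT (f \_ J) by exact/(measurable_restrictT _ _).1.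
have fE (m : {measure set T -> \bar R}) :
    (\int[m]_(x in J) (f \_ J) x = \int[m]_(x in J) f x)%E.
  by apply: eq_integral => x xJ; rewrite patchE xJ.
have mJf : measurable_fun J (f \_ J) by exact: measurable_funTS.
rewrite -!fE; apply: (@le_trans _ _ (\int[m3]_(x in J) (f \_ J) x)%E).
  apply: ge0_le_measure_integral => // S mS.
  have -> : m1 S = (m1 (S `&` J) + m1 (S `&` ~` J))%E.
    rewrite -measureU; last 3 first.
    - exact: measurableI.
    - exact: measurableI.
    - by rewrite setIACA setICr setI0.
    by rewrite -setIUr setUCr setIT.
  rewrite [leRHS](_ : _ = (m2 S + mrestr m1 mJC S)%E); last exact: measure_addE.
  rewrite leeD2r //.
  apply: (@le_trans _ _ (m2 (S `&` J))).
    by apply: m12; [exact: measurableI | exact: subIsetr].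
  by apply: le_measure; rewrite ?inE //; exact: measurableI.
rewrite ge0_integral_measure_add // (@null_set_integral _ _ _ (mrestr m1 mJC))
  //.
  by rewrite adde0.
by change (m1 (J `&` ~` J) = 0%E); rewrite setICr measure0.
Qed.

Section DensityComparison.
Variables (R : realType).
Variable mu : {finite_measure set (measurableTypeR R) -> \bar R}.
Variable w : R -> R.
Hypothesis w_density : is_ac_density mu w.
Variable J : set (measurableTypeR R).
Hypothesis mJ : measurable J.
Hypothesis JD : J `<=` `]-1, 1[%classic.
Hypothesis Jac : mrestr mu mJ `<< lebesgue_measure.
Local Notation leb := (@lebesgue_measure R).

(** The singular part nu vanishes on J. It gives no mass to N, and off N the set is Lebesgue null,
    hence mu-null by absolute continuity, while nu <= mu there. *)
Lemma ac_density_on (A : set (measurableTypeR R)) : measurable A -> A `<=` J ->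
  mu A = (\int[leb]_(x in A) (w x)%:E)%E.
Proof.
move=> mA AJ; have [mw w0 [nu [[N [mN nuN lebN] muE]]]] := w_density.
have mNC : measurable (~` N) by exact: measurableC.
have AD := subset_trans AJ JD.
rewrite muE //; suff -> : nu A = 0%E by rewrite adde0.
have mA1 : measurable (A `&` N) by exact: measurableI.
have mA2 : measurable (A `&` ~` N) by exact: measurableI.
have n1 : nu (A `&` N) = 0%E.
  by apply: subset_measure0 nuN => //; exact: subIsetr.
have n2 : nu (A `&` ~` N) = 0%E.
  apply/eqP; rewrite eq_le measure_ge0 andbT.
  have mu0 : mu (A `&` ~` N) = 0%E.
    have := (null_content_dominatesP _ _).1 Jac (A `&` ~` N) mA2;
      rewrite /mrestr.
    have A2J : A `&` ~` N `<=` J by move=> x [/AJ].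
    rewrite (setIidl A2J).
    by apply; apply: subset_measure0 lebN => //; exact: subIsetr.
  rewrite -[leRHS]mu0 muE //; last by move=> x [/AD].
  rewrite leeDr // integral_ge0 // => x [/AD xD _].
  by rewrite lee_fin w0.
have -> : A = (A `&` N) `|` (A `&` ~` N) by rewrite -setIUr setUCr setIT.
apply: etrans (measureU nu mA1 mA2 _) _; first by rewrite setIACA setICr setI0.
by transitivity (0 + 0 : \bar R)%E; [congr (_ + _)%E|rewrite adde0].
Qed.

Let mwJ : measurable_fun J (EFin \o w).
Proof.
have [mw _ _] := w_density; apply/measurable_EFinP.
exact: measurable_funS mw.
Qed.

Let w0 x : J x -> 0 <= w x.
Proof. by move=> /JD xD; have [_ h _] := w_density; exact: h. Qed.

Lemma density_measure_le (c : R) (A : set (measurableTypeR R)) : measurable A ->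
  A `<=` J -> (forall x, J x -> w x <= c) -> (mu A <= c%:E * leb A)%E.
Proof.
move=> mA AJ wc; rewrite ac_density_on // -integral_cst //.
apply: ge0_le_integral => //.
- by move=> x /AJ xJ; rewrite lee_fin w0.
- exact: measurable_funS mwJ.
- by move=> x /AJ xJ; rewrite lee_fin wc.
Qed.

Lemma density_measure_ge (c : R) (A : set (measurableTypeR R)) : measurable A ->
  A `<=` J -> 0 <= c -> (forall x, J x -> c <= w x) -> (c%:E * leb A <= mu A)%E.
Proof.
move=> mA AJ c0 wc; rewrite ac_density_on // -integral_cst //.
apply: ge0_le_integral => //.
- exact: measurable_funS mwJ.
- by move=> x /AJ xJ; rewrite lee_fin wc.
Qed.

Lemma density_integral_le (c : R) (f : R -> \bar R) : 0 <= c ->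
  (forall x, J x -> w x <= c) -> (forall x, J x -> (0 <= f x)%E) ->
  measurable_fun J f ->
  (\int[mu]_(x in J) f x <= c%:E * \int[leb]_(x in J) f x)%E.
Proof.
move=> c0 wc f0 mf.
rewrite -[c]/((NngNum c0)%:num) -ge0_integral_mscale //.
apply: ge0_le_measure_integral_on => // S mS SJ.
exact: density_measure_le.
Qed.

Lemma density_integral_ge (c : R) (f : R -> \bar R) : 0 <= c ->
  (forall x, J x -> c <= w x) -> (forall x, J x -> (0 <= f x)%E) ->
  measurable_fun J f ->
  (c%:E * \int[leb]_(x in J) f x <= \int[mu]_(x in J) f x)%E.
Proof.
move=> c0 wc f0 mf.
rewrite -[c]/((NngNum c0)%:num) -ge0_integral_mscale //.
apply: ge0_le_measure_integral_on => // S mS SJ.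
exact: density_measure_ge.
Qed.

End DensityComparison.

Lemma weighted_integralE (R : realType)
    (m : {measure set (measurableTypeR R) -> \bar R}) (v : R -> R) (P : {poly
      R}) :
  (m `](-1)%R, 1%R[%classic < +oo)%E ->
  measurable_fun (`]-1, 1[%classic : set (measurableTypeR R)) v ->
  (exists B, forall x, -1 < x < 1 -> `|v x| <= B) ->
  ((weighted_integral m v P)%:E
    = \int[m]_(x in `](-1)%R, 1%R[%classic) (P.[x] * v x)%:E)%E.
Proof.
move=> mD mv bv; rewrite /weighted_integral /Rintegral fineK //.
apply: integrable_fin_num => //; exact: (integrable_weighted mD mv bv P).
Qed.

Lemma ge0_integral_split_le d (T : measurableType d) (R : realType)
    (m : {measure set T -> \bar R}) (D J : set T) (f : T -> R) (B : R) :
  measurable D -> measurable J -> J `<=` D -> measurable_fun D f ->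
  (forall x, D x -> 0 <= f x) -> 0 <= B ->
  (forall x, D x -> ~ J x -> f x <= B) ->
  (\int[m]_(x in D) (f x)%:E <= \int[m]_(x in J) (f x)%:E + B%:E * m D)%E.
Proof.
move=> mD mJ JD mf f0 B0 fB.
have mDJ : measurable (D `\` J) by exact: measurableD.
have mfE : measurable_fun D (EFin \o f) by exact/measurable_EFinP.
rewrite -[in leLHS](setDUK JD) ge0_integral_setU //; last 3 first.
- by rewrite setDUK.
- by move=> x; rewrite setDUK // => xD; rewrite lee_fin f0.
- by rewrite disj_set2E setDIK.
rewrite leeD2l //; apply: (@le_trans _ _ (B%:E * m (D `\` J))%E).
  rewrite -integral_cst //; apply: ge0_le_integral => //.
  - by move=> x [xD _]; rewrite lee_fin f0.
  - by apply: measurable_funS mfE => // x [].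
  - by move=> x [xD xJ]; rewrite lee_fin fB.
by rewrite lee_wpmul2l ?lee_fin // le_measure ?inE //.
Qed.

(** * Two-sided comparison of mu with the Chebyshev weight on polynomials *)

Section FunctionalComparison.
Variable R : realType.
Variable mu : {finite_measure set (measurableTypeR R) -> \bar R}.
Variable w : R -> R.
Hypothesis w_density : is_ac_density mu w.
Variable J : set (measurableTypeR R).
Hypothesis mJ : measurable J.
Hypothesis JD : J `<=` `]-1, 1[%classic.
Hypothesis Jac : mrestr mu mJ `<< lebesgue_measure.
Local Notation leb := (@lebesgue_measure R).
Local Notation D := (`]-1, 1[%classic : set (measurableTypeR R)).
Local Notation om := (@cheb_weight R).

Lemma cheb_weight_ge0 x : 0 <= om x. Proof. exact: sqrtr_ge0. Qed.

Lemma cheb_weight_le1 x : om x <= 1.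
Proof.
by rewrite -[leRHS]sqrtr1 ler_wsqrtr // lerBlDr lerDl sqr_ge0.
Qed.

Lemma measurable_cheb_weight (A : set (measurableTypeR R)) : measurable_fun A
  om.
Proof.
apply: (measurable_funS measurableT) => //.
exact: continuous_measurable_fun (@continuous_cheb_weight R).
Qed.

Lemma lebesgue_measure_itvN11 : leb D = 2%:E.
Proof.
rewrite lebesgue_measure_itv /= ifT; last by rewrite lte_fin; lra.
by rewrite -EFinB opprK.
Qed.

Lemma cheb_functionalE P : ((weighted_integral leb om P)%:E
  = \int[leb]_(x in D) (P.[x] * om x)%:E)%E.
Proof.
apply: weighted_integralE; first by rewrite [X in (X <
  _)%E]lebesgue_measure_itvN11 ltry.
  exact: measurable_cheb_weight.
by exists 1 => x _; rewrite ger0_norm ?cheb_weight_ge0 ?cheb_weight_le1.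
Qed.

Lemma mu_functionalE P : ((weighted_integral mu (cst 1%R) P)%:E
  = \int[mu]_(x in D) (P.[x])%:E)%E.
Proof.
rewrite weighted_integralE.
- by apply: eq_integral => x _; rewrite /= mulr1.
- by rewrite ltey_eq fin_num_measure.
- exact: measurable_cst.
- by exists 1 => x _; rewrite normr1.
Qed.

Section Poly.
Variables (P : {poly R}) (B : R).
Hypothesis P0 : forall x, -1 < x < 1 -> 0 <= P.[x].
Hypothesis B0 : 0 <= B.
Hypothesis PB : forall x, -1 < x < 1 -> ~ J x -> P.[x] <= B.

Let DE x : D x -> -1 < x < 1. Proof. by rewrite /= in_itv. Qed.

Let PJ0 x : J x -> (0 <= (P.[x])%:E)%E.
Proof. by move=> /JD/DE xD; rewrite lee_fin P0. Qed.

(** On J, dmu <= c dx <= (c / o) om dx; off J the bound B is paid against the total mass. *)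
Lemma mu_le_cheb (c o : R) : 0 <= c -> 0 < o ->
  (forall x, J x -> w x <= c) -> (forall x, J x -> o <= om x) ->
  weighted_integral mu (cst 1) P <=
    c / o * weighted_integral leb om P + B * fine (mu D).
Proof.
move=> c0 o0 wc oo.
rewrite -lee_fin EFinD !EFinM mu_functionalE cheb_functionalE fineK
  ?fin_num_measure //.
apply: le_trans (ge0_integral_split_le mu (B := B) _ mJ JD _ _ _ _) _ => //.
- exact: measurable_horner.
rewrite leeD2r //.
have mP : measurable_fun J (fun x => (P.[x])%:E).
  by apply/measurable_EFinP; exact: measurable_horner.
apply: le_trans (density_integral_le w_density JD Jac c0 wc PJ0 mP) _.
rewrite -muleA lee_wpmul2l ?lee_fin //.
have mPo (A : set (measurableTypeR R)) : measurable_fun A (fun x => P.[x] * om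
  x).
  by apply: measurable_funM; [exact: measurable_horner | exact:
    measurable_cheb_weight].
apply: (@le_trans _ _ (\int[leb]_(x in J) (o^-1%:E * (P.[x] * om x)%:E))%E).
  apply: ge0_le_integral => //.
  - by apply: measurable_funeM; exact/measurable_EFinP.
  - move=> x xJ; have xD := DE (JD xJ).
    by rewrite -EFinM lee_fin mulrC -mulrA ler_peMr ?P0 // ler_pdivlMr // mul1r
      oo.
rewrite ge0_integralZl ?lee_fin ?invr_ge0 ?(ltW o0) //; last 2 first.
- exact/measurable_EFinP.
- by move=> x xJ; rewrite lee_fin mulr_ge0 ?cheb_weight_ge0 ?P0 ?DE //;
  exact: JD.
rewrite lee_wpmul2l ?lee_fin ?invr_ge0 ?(ltW o0) //.
apply: ge0_subset_integral => //; first exact/measurable_EFinP.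
by move=> x /DE xD; rewrite lee_fin mulr_ge0 ?cheb_weight_ge0 ?P0.
Qed.

(** The reverse comparison; 2 is the length of ]-1, 1[, on which om <= 1. *)
Lemma cheb_le_mu (c o : R) : 0 < c -> 0 <= o ->
  (forall x, J x -> c <= w x) -> (forall x, J x -> om x <= o) ->
  weighted_integral leb om P <=
    o / c * weighted_integral mu (cst 1) P + B * 2.
Proof.
move=> c0 o0 cw oo.
rewrite -lee_fin EFinD !EFinM mu_functionalE cheb_functionalE.
have mP (A : set (measurableTypeR R)) : measurable_fun A (fun x => (P.[x])%:E).
  by apply/measurable_EFinP; exact: measurable_horner.
have mPo (A : set (measurableTypeR R)) : measurable_fun A (fun x => P.[x] * om
  x).
  by apply: measurable_funM; [exact: measurable_horner | exact:
    measurable_cheb_weight].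
apply: le_trans (ge0_integral_split_le leb (B := B) _ mJ JD _ _ _ _) _ => //.
- by move=> x /DE xD; rewrite mulr_ge0 ?cheb_weight_ge0 ?P0.
- move=> x /DE xD xJ; apply: le_trans (PB xD xJ).
  by rewrite ler_piMr ?P0 ?cheb_weight_le1.
rewrite [X in (_ + B%:E * X)%E]lebesgue_measure_itvN11 leeD2r //.
apply: (@le_trans _ _ (\int[leb]_(x in J) (o%:E * (P.[x])%:E))%E).
  apply: ge0_le_integral => //.
  - by move=> x xJ; rewrite lee_fin mulr_ge0 ?cheb_weight_ge0 ?P0 ?DE //;
    exact: JD.
  - exact/measurable_EFinP.
  - by apply: measurable_funeM; exact: mP.
  - move=> x xJ; have xD := DE (JD xJ).
    by rewrite -EFinM lee_fin mulrC ler_wpM2r ?P0 ?oo.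
rewrite ge0_integralZl ?lee_fin //.
rewrite -muleA lee_wpmul2l ?lee_fin // lee_pdivlMl //.
apply: le_trans (density_integral_ge w_density JD Jac (ltW c0) cw PJ0 (mP J)) _.
by apply: ge0_subset_integral => //.
Qed.

End Poly.
End FunctionalComparison.

(** * Localization and comparison of kernels *)

Section Localization.
Variables (R : realType) (Lmu Lom : {scalar {poly R}}) (p q : nat -> {poly R}).
Hypothesis mupos : nonneg_functional Lmu.
Hypothesis ompos : nonneg_functional Lom.
Hypothesis muorth : orthonormal_for Lmu p.
Hypothesis omorth : orthonormal_for Lom q.
Variables (x0 dl c k M : R).
Hypothesis dl0 : 0 < dl.
Hypothesis dl1 : dl < 2.
Hypothesis c0 : 0 < c.
Local Notation J t := (`|t - x0| < 2 * dl).

Hypothesis mu_le : forall (P : {poly R}) (B : R),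
  (forall t, -1 < t < 1 -> 0 <= P.[t]) -> 0 <= B ->
  (forall t, -1 < t < 1 -> ~ J t -> P.[t] <= B) -> Lmu P <= c * Lom P + B * M.
Hypothesis om_le : forall (P : {poly R}) (B : R),
  (forall t, -1 < t < 1 -> 0 <= P.[t]) -> 0 <= B ->
  (forall t, -1 < t < 1 -> ~ J t -> P.[t] <= B) -> Lom P <= k * Lmu P + B * 2.

(** The factor 1/2 keeps the values in [0, 1] for x and t in ]-1, 1[, where |t - x| < 2. *)
Definition bump (x : R) : {poly R} := 1 - (2^-1 *: ('X - x%:P)) ^+ 2.

Lemma horner_bump x t : (bump x).[t] = 1 - ((t - x) / 2) ^+ 2.
Proof. by rewrite !hornerE mulrC. Qed.

Lemma size_bump x : (size (bump x) <= 3)%N.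
Proof.
apply: leq_trans (size_polyD _ _) _; rewrite size_poly1 size_polyN geq_max /=.
apply: leq_trans (size_poly_exp_leq _ _) _.
by rewrite size_scale ?size_XsubC ?invr_eq0.
Qed.

Lemma size_bump_exp x m : (size (bump x ^+ m) <= m.*2.+1)%N.
Proof.
apply: leq_trans (size_poly_exp_leq _ _) _; have := size_bump x.
by case: (size _) => [|[|[|[|]]]] //= _; lia.
Qed.

Lemma bump_ge0 x t : -1 < x < 1 -> -1 < t < 1 -> 0 <= (bump x).[t].
Proof.
move=> /andP[? ?] /andP[? ?]; rewrite horner_bump subr_ge0.
rewrite -[leLHS]real_normK ?num_real // exprn_ile1 // ler_norml.
by apply/andP; split; lra.
Qed.

Lemma bump_le1 x t : (bump x).[t] <= 1.
Proof. by rewrite horner_bump gerBl sqr_ge0. Qed.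

(** J has radius 2 dl so that a point outside it is at distance at least dl from every x within dl
    of x0. *)
Lemma bump_far x t : `|x - x0| < dl -> ~ J t ->
  (bump x).[t] <= 1 - (dl / 2) ^+ 2.
Proof.
move=> xd /negP; rewrite -leNgt => td; rewrite horner_bump lerD2l lerN2.
rewrite -[leRHS]real_normK ?num_real // lerXn2r ?nnegrE ?divr_ge0 ?(ltW dl0) //.
rewrite normrM normfV [`|2|]ger0_norm // ler_wpM2r ?invr_ge0 //.
have := ler_distD x t x0; lra.
Qed.

Local Notation rho := (1 - (dl / 2) ^+ 2).

Lemma rho_ge0 : 0 <= rho.
Proof.
rewrite subr_ge0 exprn_ile1 ?divr_ge0 ?(ltW dl0) //.
by rewrite ler_pdivrMr // mul1r ltW.
Qed.

Let bump_exp_far x t m : -1 < x < 1 -> -1 < t < 1 ->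
  `|x - x0| < dl -> ~ J t -> (bump x).[t] ^+ m <= rho ^+ m.
Proof.
move=> xI tI xd tJ; apply: lerXn2r; rewrite ?nnegrE ?rho_ge0 ?bump_ge0 //.
exact: bump_far.
Qed.

(* The kernel of Lom is tested on K_n(x,.) times a power of the bump. *)
Lemma kernel_upper n m x (E : R) : 0 <= k -> (0 < n)%N -> -1 < x < 1 -> `|x -
  x0| < dl ->
  (forall t, -1 < t < 1 -> kernel_K p n t t <= E) ->
  kernel_K p n x x <=
    kernel_K q (n + m.*2) x x * (k + 2 * E * rho ^+ m.*2).
Proof.
move=> k0 n0 xI xd hE; have K0 := kernel_K_gt0 muorth x n0.
have N0 : (0 < n + m.*2)%N by rewrite addn_gt0 n0.
have H0 := kernel_K_gt0 omorth x N0.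
set K := kernel_K p n x x in K0 *; set H := kernel_K q _ _ _ in H0 *.
have E0 : 0 <= E by apply: le_trans (hE x xI); exact: ltW.
pose f := kernel_poly p n x; pose Q := f * bump x ^+ m.
have sQ : (size Q <= n + m.*2)%N.
  apply: leq_trans (size_polyMleq _ _) _.
  have := leq_add (size_kernel_poly muorth n x) (size_bump_exp x m).
  by rewrite addnS -/f; case: (_ + _)%N.
have Qx : Q.[x] = K.
  rewrite hornerM horner_exp horner_bump subrr mul0r expr0n subr0 expr1n mulr1.
  by rewrite horner_kernel_poly.
have := kernel_poly_cs ompos omorth x N0 sQ; rewrite Qx -/H => h1.
have Q0 t : -1 < t < 1 -> 0 <= (Q ^+ 2).[t] by rewrite horner_exp sqr_ge0.
(* The Christoffel inequality at t, applied to K_n(x,.) itself: K_n(x,t)^2 <= K_n(t,t) K_n(x,x). The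
   factor K is cancelled at the end. *)
have fE t : -1 < t < 1 -> f.[t] ^+ 2 <= E * K.
  move=> tI; have := kernel_poly_cs mupos muorth t n0 (size_kernel_poly muorth
    n x).
  move/le_trans; apply; rewrite kernel_poly_sqr // ler_wpM2r ?(ltW K0) //.
  exact: hE.
have QB t : -1 < t < 1 -> ~ J t -> (Q ^+ 2).[t] <= E * K * rho ^+ m.*2.
  move=> tI tJ; rewrite horner_exp hornerM horner_exp exprMn -exprM muln2.
  by rewrite ler_pM ?sqr_ge0 ?fE ?bump_exp_far // exprn_ge0 // bump_ge0.
have B0 : 0 <= E * K * rho ^+ m.*2.
  by rewrite mulr_ge0 ?exprn_ge0 ?rho_ge0 // mulr_ge0 // ltW.
have h2 := om_le Q0 B0 QB.
have h3 : Lmu (Q ^+ 2) <= K.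
  rewrite -[leRHS](kernel_poly_sqr muorth) -subr_ge0 -raddfB;
    apply: mupos => t tI.
  rewrite hornerD hornerN subr_ge0 !horner_exp hornerM horner_exp exprMn.
  by rewrite ler_piMr ?sqr_ge0 // -exprM exprn_ile1 ?bump_ge0 ?bump_le1.
have h4 : Lom (Q ^+ 2) <= k * K + E * K * rho ^+ m.*2 * 2.
  by apply: le_trans h2 _; rewrite lerD2r ler_wpM2l.
have := le_trans h1 (ler_wpM2l (ltW H0) h4).
rewrite [leRHS](_ : _ = H * (k + 2 * E * rho ^+ m.*2) * K); last by ring.
by rewrite expr2 ler_pM2r.
Qed.

(** H / c is the kernel of c sqrt(1-t^2) dt, whence the division by c. The condition n' + 2m <= n
    keeps the test polynomial among those reproduced by K_n. *)
Lemma kernel_compare n n' m x y (A : R) : (0 < n)%N -> (n' + m.*2 <= n)%N ->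
  -1 < x < 1 -> -1 < y < 1 -> `|x - x0| < dl ->
  (forall t, -1 < t < 1 -> `|kernel_K q n' x t| <= A) ->
  (kernel_K p n x y - kernel_K q n' x y * (bump x).[y] ^+ m / c) ^+ 2 <=
  kernel_K p n y y * (kernel_K p n x x - kernel_K q n' x x / c
    + A ^+ 2 * rho ^+ m.*2 * M / c ^+ 2).
Proof.
move=> n0 nn xI yI xd hA.
pose f := kernel_poly p n x; pose h := kernel_poly q n' x.
pose Q := h * bump x ^+ m; pose G := c^-1 *: Q.
have A0 : 0 <= A by apply: le_trans (hA x xI).
have sG : (size G <= n)%N.
  apply: leq_trans (size_scale_leq _ _) _.
  apply: leq_trans (size_polyMleq _ _) _.
  apply: leq_trans nn.
  have := leq_add (size_kernel_poly omorth n' x) (size_bump_exp x m).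
  by rewrite addnS -/h; case: (_ + _)%N.
have sf := size_kernel_poly muorth n x.
have GE t : G.[t] = kernel_K q n' x t * (bump x).[t] ^+ m / c.
  by rewrite hornerZ hornerM horner_exp horner_kernel_poly mulrC.
have Gx : G.[x] = kernel_K q n' x x / c.
  by rewrite GE horner_bump subrr mul0r expr0n subr0 expr1n mulr1.
have sfG : (size (f - G)%R <= n)%N.
  by apply: leq_trans (size_polyD _ _) _; rewrite geq_max size_polyN sf.
have := kernel_poly_cs mupos muorth y n0 sfG.
rewrite hornerD hornerN GE horner_kernel_poly => /le_trans; apply.
rewrite ler_wpM2l ?(ltW (kernel_K_gt0 muorth y n0)) //.
(* The cross term reproduces to -2 G(x) = -2 H / c; since the last term is at most H / c plus an
   error, a single -H / c survives. *)
have -> : (f - G) ^+ 2 = f ^+ 2 - (G * f) *+ 2 + G ^+ 2 by ring.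
rewrite raddfD raddfB raddfMn /= kernel_poly_sqr // kernel_poly_repro // Gx.
have Q0 t : -1 < t < 1 -> 0 <= (Q ^+ 2).[t] by rewrite horner_exp sqr_ge0.
have QB t : -1 < t < 1 -> ~ J t -> (Q ^+ 2).[t] <= A ^+ 2 * rho ^+ m.*2.
  move=> tI tJ; rewrite horner_exp hornerM horner_exp exprMn -exprM muln2.
  rewrite ler_pM ?sqr_ge0 ?bump_exp_far //; last first.
    by rewrite horner_kernel_poly -[leLHS]real_normK ?num_real // lerXn2r
      ?nnegrE // hA.
  by rewrite exprn_ge0 // bump_ge0.
have B0 : 0 <= A ^+ 2 * rho ^+ m.*2.
  by rewrite mulr_ge0 ?sqr_ge0 ?exprn_ge0 ?rho_ge0.
have h2 := mu_le Q0 B0 QB.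
have h3 : Lom (Q ^+ 2) <= kernel_K q n' x x.
  rewrite -[leRHS](kernel_poly_sqr omorth) -subr_ge0 -raddfB;
    apply: ompos => t tI.
  rewrite hornerD hornerN subr_ge0 !horner_exp hornerM horner_exp exprMn.
  by rewrite ler_piMr ?sqr_ge0 // -exprM exprn_ile1 ?bump_ge0 ?bump_le1.
have LG : Lmu (G ^+ 2) = Lmu (Q ^+ 2) / c ^+ 2.
  by rewrite exprZn functionalZ exprVn mulrC.
have : Lmu (G ^+ 2) <= kernel_K q n' x x / c + A ^+ 2 * rho ^+ m.*2 * M / c ^+
  2.
  rewrite LG.
  have -> : kernel_K q n' x x / c = c * kernel_K q n' x x / c ^+ 2.
    by field; rewrite gt_eqF.
  rewrite -mulrDl ler_wpM2r ?invr_ge0 ?sqr_ge0 //.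
  by apply: le_trans h2 _; rewrite lerD2r ler_wpM2l // ltW.
lra.
Qed.

End Localization.

(** * Passage to the limit *)

Lemma bernoulli_le (R : realFieldType) (z : R) m :
  0 <= z <= 1 -> 1 - m%:R * z <= (1 - z) ^+ m.
Proof.
move=> /andP[z0 z1]; elim: m => [|m IH]; first by rewrite mul0r subr0 expr0.
rewrite exprS; apply: le_trans (ler_wpM2l _ IH); last by rewrite subr_ge0.
rewrite -natr1; have : 0 <= m%:R * z * z by rewrite !mulr_ge0.
nra.
Qed.

Section FilterLimits.
Variable R : realType.
Context {I : Type} {F : set_system I} {FF : Filter F}.
Variable N : I -> nat.
Hypothesis Noo : forall k, \forall i \near F, (k <= N i)%N.

Lemma exp_decay_cvg0 j (b : R) : 0 < b ->
  (N i)%:R ^+ j * expR (- (b * (N i)%:R)) @[i --> F] --> (0 : R).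
Proof.
(* Keeping only the term of order j + 1 of the exponential series leaves the bound C / N. *)
move=> b0; pose C := j.+1`!%:R / b ^+ j.+1.
have C0 : C / (N i)%:R @[i --> F] --> (0 : R).
  by rewrite -(mulr0 C); apply: cvgM; [exact: cvg_cst|exact: inv_cvg0].
apply: squeeze_cvgr (cvg_cst 0) C0; near=> i.
rewrite mulr_ge0 ?exprn_ge0 ?expR_ge0 //=.
have N0 : 0 < (N i)%:R :> R by rewrite ltr0n; near: i; exact: Noo.
have C_gt0 : 0 < C by rewrite divr_gt0 ?exprn_gt0 ?ltr0n ?fact_gt0.
rewrite expRN ler_pdivrMr ?expR_gt0 // -ler_pdivrMl ?(divr_gt0 C_gt0) //.
have bN : 0 <= b * (N i)%:R by rewrite mulr_ge0 // ltW.
apply: le_trans (expR_ge1Dxn j bN); apply: ler_wpDl => //.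
rewrite exprMn /C [(N i)%:R ^+ j.+1]exprSr.
have f0 : (j.+1)`!%:R != 0 :> R by rewrite pnatr_eq0 -lt0n fact_gt0.
have bj0 : b ^+ j.+1 != 0 by rewrite expf_neq0 // gt_eqF.
have : (N i)%:R != 0 :> R by rewrite gt_eqF.
move: ((j.+1)`!%:R : R) (b ^+ j.+1) ((N i)%:R ^+ j) f0 bj0 => f bj nj f0 bj0 n0.
rewrite [leLHS](_ : _ = bj * (nj * (N i)%:R) / f) //; field.
by rewrite f0 n0 bj0.
Unshelve. all: by end_near. Qed.

Lemma truncn_ratio_cvg (eta : R) : 0 < eta ->
  (Num.truncn (eta * (N i)%:R))%:R / (N i)%:R @[i --> F] --> eta.
Proof.
move=> e0.
have lo : eta - (N i)%:R^-1 @[i --> F] --> eta.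
  by rewrite -[X in _ --> X]subr0; apply: cvgB;
    [exact: cvg_cst|exact: inv_cvg0].
apply: squeeze_cvgr lo (cvg_cst eta); near=> i.
have N0 : 0 < (N i)%:R :> R by rewrite ltr0n; near: i; exact: Noo.
have eN : 0 <= eta * (N i)%:R by rewrite mulr_ge0 // ltW.
have /andP[h1 h2] := truncn_itv eN.
rewrite ler_pdivrMr // ler_pdivlMr // mulrBl mulVf ?gt_eqF // h1 andbT.
by rewrite lerBlDr natr1 ltW.
Unshelve. all: by end_near. Qed.

Section Comparison.
Variables (Lmu Lom : {scalar {poly R}}) (p : nat -> {poly R}).
Hypothesis mupos : nonneg_functional Lmu.
Hypothesis ompos : nonneg_functional Lom.
Hypothesis muorth : orthonormal_for Lmu p.
Hypothesis omorth : orthonormal_for Lom (@chebu R).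
Hypothesis psub : forall e, 0 < e -> exists2 C, 0 < C &
  forall k x, -1 <= x <= 1 -> `|(p k).[x]| <= C * expR (e * k%:R).
Variables (x0 s : R) (X Y : I -> R).
Hypothesis x0I : -1 < x0 < 1.
Hypothesis Xx0 : X i @[i --> F] --> x0.
Hypothesis Yx0 : Y i @[i --> F] --> x0.
Hypothesis NXY : (N i)%:R * (X i - Y i) @[i --> F] --> s.
Local Notation g := ((pi * cheb_weight x0 ^+ 2)^-1).

Lemma kernel_diag_le (C e : R) n t :
  (forall k x, -1 <= x <= 1 -> `|(p k).[x]| <= C * expR (e * k%:R)) ->
  0 <= e -> -1 < t < 1 ->
  kernel_K p n t t <= n%:R * (C * expR (e * n%:R)) ^+ 2.
Proof.
move=> pC e0 /andP[t0 t1]; have tI : -1 <= t <= 1 by rewrite !ltW.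
have C0 : 0 <= C by have := le_trans (normr_ge0 _) (pC 0 t tI);
  rewrite mulr0 expR0 mulr1.
rewrite mulr_natl -[X in _ *+ X](card_ord n) -sumr_const; apply: ler_sum => k _.
rewrite -expr2 -[leLHS]real_normK ?num_real // lerXn2r ?nnegrE //.
  by rewrite mulr_ge0 ?expR_ge0.
apply: le_trans (pC k t tI) _;
  rewrite ler_wpM2l // ler_expR ler_wpM2l // ler_nat.
exact: ltnW.
Qed.

Section Step.
Variables (eta c k M dl : R).
Hypothesis eta0 : 0 < eta.
Hypothesis eta1 : eta < 2^-1.
Hypothesis dl0 : 0 < dl.
Hypothesis dl1 : dl < 2.
Hypothesis c0 : 0 < c.
Hypothesis k0 : 0 <= k.
Local Notation J t := (`|t - x0| < 2 * dl).
Hypothesis mu_le : forall (P : {poly R}) (B : R),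
  (forall t, -1 < t < 1 -> 0 <= P.[t]) -> 0 <= B ->
  (forall t, -1 < t < 1 -> ~ J t -> P.[t] <= B) -> Lmu P <= c * Lom P + B * M.
Hypothesis om_le : forall (P : {poly R}) (B : R),
  (forall t, -1 < t < 1 -> 0 <= P.[t]) -> 0 <= B ->
  (forall t, -1 < t < 1 -> ~ J t -> P.[t] <= B) -> Lom P <= k * Lmu P + B * 2.

Let m i := Num.truncn (eta * (N i)%:R).
(** [n1] leaves room for the degree 2m of the bump power, [n2] accommodates K_n times that power. As
    eta < 1/2, [n1] still tends to infinity. *)
Let n1 i := (N i - (m i).*2)%N.
Let n2 i := (N i + (m i).*2)%N.
Let N0 : \forall i \near F, (N i)%:R != 0 :> R.
Proof. by have := Noo 1; apply: filterS => i; rewrite pnatr_eq0 lt0n. Qed.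

Let m_le : \forall i \near F, ((m i).*2 <= N i)%N.
Proof.
near=> i; rewrite -(ler_nat R) -muln2 natrM.
have eN : 0 <= eta * (N i)%:R by rewrite mulr_ge0 // ltW.
have /andP[h1 _] := truncn_itv eN.
apply: (@le_trans _ _ (eta * (N i)%:R * 2)); first by rewrite ler_wpM2r.
by rewrite mulrAC ler_piMl // -ler_pdivlMr // mul1r ltW.
Unshelve. all: by end_near. Qed.

Let n1_cvg : (n1 i)%:R / (N i)%:R @[i --> F] --> 1 - eta * 2.
Proof.
apply: (@cvg_near_eq _ _ _ _ (fun i => 1 - (m i)%:R / (N i)%:R * 2)).
  near=> i; rewrite natrB; last by near: i.
  by rewrite mulrBl divff; [rewrite -muln2 natrM mulrAC | near: i].
apply: cvgB; first exact: cvg_cst.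
by apply: cvgM; [exact: truncn_ratio_cvg | exact: cvg_cst].
Unshelve. all: by end_near. Qed.

Let n2_cvg : (n2 i)%:R / (N i)%:R @[i --> F] --> 1 + eta * 2.
Proof.
apply: (@cvg_near_eq _ _ _ _ (fun i => 1 + (m i)%:R / (N i)%:R * 2)).
  near=> i; rewrite natrD.
  by rewrite mulrDl divff; [rewrite -muln2 natrM mulrAC | near: i].
apply: cvgD; first exact: cvg_cst.
by apply: cvgM; [exact: truncn_ratio_cvg | exact: cvg_cst].
Unshelve. all: by end_near. Qed.

Let n2oo j : \forall i \near F, (j <= n2 i)%N.
Proof. by have := Noo j; apply: filterS => i h;
  rewrite (leq_trans h) // leq_addr. Qed.

Let n1oo j : \forall i \near F, (j <= n1 i)%N.
Proof.
have q0 : 0 < 1 - eta * 2 by rewrite subr_gt0 -ltr_pdivlMr // mul1r.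
pose q := (1 - eta * 2) / 2.
have q_gt0 : 0 < q by rewrite divr_gt0.
have q_lt : q < 1 - eta * 2 by rewrite ltr_pdivrMr // ltr_pMr // ltr1n.
have h := cvgr_gt _ n1_cvg _ q_lt.
have hj := Noo (Num.truncn (j%:R / q)).+1.
near=> i; rewrite -(ler_nat R).
have Ni : 0 < (N i)%:R :> R by rewrite ltr0n; near: i; exact: Noo.
have h1 : q * (N i)%:R < (n1 i)%:R by rewrite -ltr_pdivlMr //; near: i;
  exact: h.
apply: le_trans (ltW h1); rewrite mulrC -ler_pdivrMr //.
apply: le_trans (ltW (truncnS_gt _)) _; rewrite ler_nat; near: i; exact: hj.
Unshelve. all: by end_near. Qed.

Let kernel_ratio_cvg (n : I -> nat) (r d : R) (U V : I -> R) :
  (forall j, \forall i \near F, (j <= n i)%N) ->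
  (n i)%:R / (N i)%:R @[i --> F] --> r ->
  U i @[i --> F] --> x0 -> V i @[i --> F] --> x0 ->
  (N i)%:R * (U i - V i) @[i --> F] --> d ->
  kernel_K (@chebu R) (n i) (U i) (V i) / (N i)%:R
    @[i --> F] --> r * (sinc (r * d / cheb_weight x0) * g).
Proof.
move=> noo nr Ux Vx UV.
have nUV : (n i)%:R * (U i - V i) @[i --> F] --> r * d.
  apply: (@cvg_near_eq _ _ _ _
    (fun i => (n i)%:R / (N i)%:R * ((N i)%:R * (U i - V i))));
      last exact: cvgM.
  by near=> i; rewrite mulrA divfK //; near: i.
have /(_ FF) H := kernel_chebu_cvg noo x0I Ux Vx nUV.
apply: (@cvg_near_eq _ _ _ _ (fun i => (n i)%:R / (N i)%:R *
  (kernel_K (@chebu R) (n i) (U i) (V i) / (n i)%:R))); last exact: cvgM.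
near=> i; have ni0 : (n i)%:R != 0 :> R.
  by rewrite pnatr_eq0 -lt0n; near: i; exact: noo.
by rewrite mulrCA mulrAC divff // mul1r.
Unshelve. all: by end_near. Qed.

Local Notation rho := (1 - (dl / 2) ^+ 2).

Let rho_gt0 : 0 < rho.
Proof.
have dl2 : 0 <= dl / 2 by rewrite divr_ge0 // ltW.
by rewrite subr_gt0 expr_lt1 // ltr_pdivrMr // mul1r.
Qed.

Let tau := - ln rho.

Let tau_gt0 : 0 < tau.
Proof.
rewrite oppr_gt0 ln_lt0 // rho_gt0 /= gtrBl exprn_gt0 // divr_gt0 //.
Qed.

(** Since m > eta N - 1; the factor e^(2 tau) pays for the truncation. *)
Let rho_exp : \forall i \near F,
  rho ^+ (m i).*2 <= expR (2 * tau) * expR (- (2 * tau * eta * (N i)%:R)).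
Proof.
near=> i; have -> : rho = expR (- tau) by rewrite opprK lnK.
rewrite -expRD -expRM_natr ler_expR.
have eN : 0 <= eta * (N i)%:R by rewrite mulr_ge0 // ltW.
have /andP[_ h2] := truncn_itv eN.
have := ler_wpM2l (ltW tau_gt0) (ltW h2).
rewrite -/(m i) -muln2 natrM -natr1 => h.
lra.
Unshelve. all: by end_near. Qed.

Let near_D (U : I -> R) : U i @[i --> F] --> x0 ->
  \forall i \near F, -1 < U i < 1 /\ `|U i - x0| < dl.
Proof.
move=> Ux; have /andP[x0l x0r] := x0I.
have h1 := cvgr_gt _ Ux _ x0l; have h2 := cvgr_lt _ Ux _ x0r.
have /cvgrPdist_lt/(_ _ dl0) h3 := Ux.
near=> i; split; last by rewrite distrC; near: i; exact: h3.
by apply/andP; split; near: i; [exact: h1|exact: h2].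
Unshelve. all: by end_near. Qed.

(** By Bernoulli the defect from 1 is at most N (X - Y)^2 / 4, where N (X - Y) converges and X - Y
    tends to 0. *)
Let bump_cvg1 : (bump (X i)).[Y i] ^+ m i @[i --> F] --> (1 : R).
Proof.
pose z i := ((Y i - X i) / 2) ^+ 2.
have lo : 1 - (N i)%:R * (X i - Y i) * (X i - Y i) * (2^-1 ^+ 2) @[i --> F] -->
  (1 : R).
  rewrite -[X in _ --> X]subr0 -(mul0r (2^-1 ^+ 2)) -[X in X * _](mulr0 s).
  apply: cvgB; first exact: cvg_cst.
  apply: cvgM; last exact: cvg_cst.
  by apply: cvgM => //; rewrite -(subrr x0); exact: cvgB.
have hX := near_D Xx0; have hY := near_D Yx0.
apply: squeeze_cvgr lo (cvg_cst (1 : R)); near=> i.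
have [XI _] : -1 < X i < 1 /\ `|X i - x0| < dl by near: i.
have [YI _] : -1 < Y i < 1 /\ `|Y i - x0| < dl by near: i.
rewrite exprn_ile1 ?bump_ge0 ?bump_le1 // andbT horner_bump.
apply: le_trans (bernoulli_le (m i) _); last first.
  rewrite sqr_ge0 /=; have := bump_ge0 XI YI; rewrite horner_bump; lra.
have mN : (m i)%:R <= (N i)%:R :> R.
  rewrite ler_nat; apply: (@leq_trans (m i).*2); last by near: i.
  by rewrite -addnn leq_addr.
rewrite lerD2l lerN2 -mulrA -mulrA.
apply: le_trans (ler_wpM2r (sqr_ge0 _) mN) _.
by rewrite [leLHS](_ : _ = (N i)%:R * ((X i - Y i) * ((X i - Y i) * 2^-1 ^+
  2))) //; ring.
Unshelve. all: by end_near. Qed.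

Hypothesis M0 : 0 <= M.

(** The state of the argument at fixed eta: [a] is the explicit approximation of K_n(x,y) / n, and
    [D] bounds its squared error. The limit of [D] is not 0, but tends to 0 with eta when c and k
    approach inverse values. *)
Lemma kernel_step : exists a D : I -> R,
  [/\ a i @[i --> F] --> (1 - eta * 2) *
        (sinc ((1 - eta * 2) * s / cheb_weight x0) * g) / c,
      D i @[i --> F] --> (1 + eta * 2) * g * k *
        `|(1 + eta * 2) * g * k - (1 - eta * 2) * g / c| &
      \forall i \near F,
        (kernel_K p (N i) (X i) (Y i) / (N i)%:R - a i) ^+ 2 <= D i].
Proof.
have te0 : 0 < tau * eta by rewrite mulr_gt0.
(* The bound on K_n(v,v) then grows at rate 2 e = tau eta, half the decay rate 2 tau eta of
   rho^(2m). *)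
pose e := tau * eta / 2; have e0 : 0 < e by rewrite divr_gt0.
have [C C0 pC] := psub e0.
pose Kq := kernel_K (@chebu R).
pose t i := 2 * C ^+ 2 * expR (2 * tau)
  * ((N i)%:R ^+ 1 * expR (- (tau * eta * (N i)%:R))).
(* The power 5 is that of (N^3)^2 / N, with N^3 from [kernel_chebu_le]. *)
pose z i := expR (2 * tau) * M / c ^+ 2
  * ((N i)%:R ^+ 5 * expR (- (2 * tau * eta * (N i)%:R))).
have t_cvg : k + t i @[i --> F] --> k.
  rewrite -[X in _ --> X]addr0; apply: cvgD; first exact: cvg_cst.
  rewrite -(mulr0 (2 * C ^+ 2 * expR (2 * tau))).
  by apply: cvgM; [exact: cvg_cst | exact: exp_decay_cvg0].
have z_cvg : z i @[i --> F] --> 0.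
  rewrite -(mulr0 (expR (2 * tau) * M / c ^+ 2)).
  apply: cvgM; [exact: cvg_cst | apply: exp_decay_cvg0 => //].
  by rewrite -mulrA mulr_gt0.
have diag0 (U : I -> R) : (N i)%:R * (U i - U i) @[i --> F] --> 0.
  by under eq_fun do rewrite subrr mulr0; exact: cvg_cst.
have sinc00 : sinc (0 : R) = 1 by rewrite /sinc eqxx.
have diag (n : I -> nat) (r : R) (U : I -> R) : (forall j, \forall i \near F,
  (j <= n i)%N) ->
    (n i)%:R / (N i)%:R @[i --> F] --> r -> U i @[i --> F] --> x0 ->
    Kq (n i) (U i) (U i) / (N i)%:R @[i --> F] --> r * g.
  move=> noo nr Ux; have := kernel_ratio_cvg noo nr Ux Ux (diag0 U).
  by rewrite mulr0 mul0r sinc00 mul1r.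
exists (fun i => Kq (n1 i) (X i) (Y i) / (N i)%:R * (bump (X i)).[Y i] ^+ m i /
  c).
(* The absolute value makes the second factor nonnegative, so that K_n(y,y) / n can then be replaced
   by its upper bound. *)
exists (fun i => Kq (n2 i) (Y i) (Y i) / (N i)%:R * (k + t i) *
  `|Kq (n2 i) (X i) (X i) / (N i)%:R * (k + t i)
     - Kq (n1 i) (X i) (X i) / (N i)%:R / c + z i|).
split.
- apply: cvgM; last exact: cvg_cst.
  rewrite -[X in _ --> X]mulr1; apply: cvgM; last exact: bump_cvg1.
  exact: kernel_ratio_cvg.
- apply: cvgM; first by apply: cvgM => //; exact: diag.
  apply: cvg_norm; rewrite -[X in _ --> X]addr0; apply: cvgD => //.
  apply: cvgB; first by apply: cvgM => //; exact: diag.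
  by apply: cvgM; [exact: diag | exact: cvg_cst].
have hX := near_D Xx0; have hY := near_D Yx0; have hN := Noo 1.
near=> i.
have [XI Xd] : -1 < X i < 1 /\ `|X i - x0| < dl by near: i.
have [YI Yd] : -1 < Y i < 1 /\ `|Y i - x0| < dl by near: i.
have Ni : (0 < N i)%N by near: i.
have mN : ((m i).*2 <= N i)%N by near: i; exact: m_le.
have rE : rho ^+ (m i).*2 <= expR (2 * tau) * expR (- (2 * tau * eta * (N
  i)%:R)).
  by near: i; exact: rho_exp.
have NR0 : 0 < (N i)%:R :> R by rewrite ltr0n.
pose E := (N i)%:R * (C * expR (e * (N i)%:R)) ^+ 2.
have hE v : -1 < v < 1 -> kernel_K p (N i) v v <= E.
  by move=> vI; apply: kernel_diag_le => //; exact: ltW.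
have E0 : 0 <= E by rewrite mulr_ge0 ?sqr_ge0.
have Et : 2 * E * rho ^+ (m i).*2 <= t i.
  apply: le_trans (ler_wpM2l _ rE) _; first by rewrite mulr_ge0.
  rewrite /t /E exprMn -expRM_natl expr1.
  rewrite [leLHS](_ : _ = 2 * C ^+ 2 * expR (2 * tau) * ((N i)%:R *
    (expR (2 * (e * (N i)%:R)) * expR (- (2 * tau * eta * (N i)%:R)))));
      last by ring.
  rewrite -expRD (_ : 2 * (e * (N i)%:R) - _ = - (tau * eta * (N i)%:R)) //.
  by rewrite /e; field.
have up v : -1 < v < 1 -> `|v - x0| < dl ->
    kernel_K p (N i) v v / (N i)%:R <= Kq (n2 i) v v / (N i)%:R * (k + t i).
  move=> vI vd; rewrite mulrAC ler_wpM2r ?invr_ge0 //.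
  have := kernel_upper mupos ompos muorth omorth dl0 dl1 c0 om_le (m i) k0 Ni
    vI vd hE.
  move/le_trans; apply; rewrite ler_wpM2l ?lerD2l //.
  by apply/ltW/(kernel_K_gt0 omorth); rewrite addn_gt0 Ni.
have hA y : -1 < y < 1 -> `|Kq (n1 i) (X i) y| <= (N i)%:R ^+ 3.
  move=> /andP[y0 y1]; have /andP[X0 X1] := XI.
  have Xc : -1 <= X i <= 1 by rewrite !ltW.
  have yc : -1 <= y <= 1 by rewrite !ltW.
  apply: le_trans (kernel_chebu_le (n1 i) Xc yc) _.
  by rewrite lerXn2r ?nnegrE // ler_nat leq_subr.
have nle : (n1 i + (m i).*2 <= N i)%N by rewrite subnK.
have := kernel_compare mupos ompos muorth omorth dl0 dl1 c0 mu_le Ni nle XI YI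
  Xd hA.
set Kxy := kernel_K p (N i) (X i) (Y i);
  set Kyy := kernel_K p (N i) (Y i) (Y i).
set Kxx := kernel_K p (N i) (X i) (X i); set bm := _ ^+ m i.
set S := Kxx - _ + _ => h.
have N2 : 0 < (N i)%:R ^+ 2 :> R by rewrite exprn_gt0.
have n0 : (N i)%:R != 0 :> R by rewrite gt_eqF.
have cn0 : c != 0 by rewrite gt_eqF.
have Kyy0 : 0 <= Kyy / (N i)%:R.
  by rewrite divr_ge0 // ltW // (kernel_K_gt0 muorth).
rewrite [leLHS](_ : _ = (Kxy - Kq (n1 i) (X i) (Y i) * bm / c) ^+ 2
  / (N i)%:R ^+ 2); last by field; rewrite n0 cn0.
apply: (@le_trans _ _ (Kyy / (N i)%:R * (S / (N i)%:R))).
  rewrite (_ : Kyy / _ * _ = Kyy * S / (N i)%:R ^+ 2); last by field.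
  by rewrite ler_wpM2r // invr_ge0 ltW.
have SN : S / (N i)%:R <= Kq (n2 i) (X i) (X i) / (N i)%:R * (k + t i)
     - Kq (n1 i) (X i) (X i) / (N i)%:R / c + z i.
  rewrite /S mulrDl mulrBl; apply: lerD; first apply: lerB.
  - exact: up.
  - by rewrite mulrAC.
  rewrite /z -exprM.
  rewrite [leLHS](_ : _ = M / c ^+ 2 * ((N i)%:R ^+ 5 * rho ^+ (m i).*2));
    last first.
    by field; rewrite n0 cn0.
  rewrite [leRHS](_ : _ = M / c ^+ 2 * ((N i)%:R ^+ 5 *
    (expR (2 * tau) * expR (- (2 * tau * eta * (N i)%:R))))); last by field.
  by rewrite ler_wpM2l ?divr_ge0 ?sqr_ge0 // ler_wpM2l ?exprn_ge0.
apply: le_trans (ler_wpM2l Kyy0 (le_trans SN (ler_norm _))) _.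
by rewrite ler_wpM2r ?normr_ge0 // up.
Unshelve. all: by end_near. Qed.

End Step.
Variables (th M : R).
Hypothesis th0 : 0 < th.
Hypothesis M0 : 0 <= M.
Hypothesis compar : forall eta, 0 < eta -> exists2 dl, 0 < dl < 2 &
  (forall (P : {poly R}) (B : R),
    (forall t, -1 < t < 1 -> 0 <= P.[t]) -> 0 <= B ->
    (forall t, -1 < t < 1 -> ~ (`|t - x0| < 2 * dl) -> P.[t] <= B) ->
    Lmu P <= th * (1 + eta) * Lom P + B * M /\
    Lom P <= th^-1 * (1 + eta) * Lmu P + B * 2).

(** [A] and [D] are the limits given by [kernel_step] with c = th (1 + eta) and k = (1 + eta) / th.
    Both are continuous at eta = 0, and D 0 = 0. *)
Lemma kernel_cvg : kernel_K p (N i) (X i) (Y i) / (N i)%:R @[i --> F]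
  --> sinc (s / cheb_weight x0) * g / th.
Proof.
pose A (eta : R) := (1 - eta * 2) *
  (sinc ((1 - eta * 2) * s / cheb_weight x0) * g) / (th * (1 + eta)).
pose D (eta : R) := (1 + eta * 2) * g * (th^-1 * (1 + eta)) *
  `|(1 + eta * 2) * g * (th^-1 * (1 + eta)) - (1 - eta * 2) * g / (th * (1 +
    eta))|.
have A0 : A 0 = sinc (s / cheb_weight x0) * g / th.
  by rewrite /A mul0r subr0 addr0 !mul1r mulr1.
have D0 : D 0 = 0.
  by rewrite /D mul0r subr0 addr0 !mul1r !mulr1 subrr normr0 mulr0.
have c1 (b : R) : eta * b @[eta --> (0 : R)] --> (0 * b : R).
  by apply: cvgM; [exact: cvg_id | exact: cvg_cst].
have cm : 1 - eta * 2 @[eta --> (0 : R)] --> (1 - 0 * 2 : R).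
  by apply: cvgB => //; exact: cvg_cst.
have cp : 1 + eta * 2 @[eta --> (0 : R)] --> (1 + 0 * 2 : R).
  by apply: cvgD => //; exact: cvg_cst.
have ct : 1 + eta @[eta --> (0 : R)] --> (1 + 0 : R).
  by apply: cvgD; [exact: cvg_cst | exact: cvg_id].
have ctV : (th * (1 + eta))^-1 @[eta --> (0 : R)] --> (th * (1 + 0))^-1.
  apply: cvgV; first by rewrite addr0 mulr1 gt_eqF.
  by apply: cvgM => //; exact: cvg_cst.
have cA : A eta @[eta --> (0 : R)] --> A 0.
  apply: cvgM => //; apply: cvgM => //; apply: cvgM; last exact: cvg_cst.
  apply: continuous_cvg; first exact: continuous_sinc.
  apply: cvgM; last exact: cvg_cst.
  by apply: cvgM => //; exact: cvg_cst.
have cpg : (1 + eta * 2) * g * (th^-1 * (1 + eta)) @[eta --> (0 : R)]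
    --> (1 + 0 * 2) * g * (th^-1 * (1 + 0)).
  apply: cvgM; first by apply: cvgM => //; exact: cvg_cst.
  by apply: cvgM => //; exact: cvg_cst.
have cD : D eta @[eta --> (0 : R)] --> D 0.
  apply: cvgM => //; apply: cvg_norm; apply: cvgB => //.
  by apply: cvgM => //; apply: cvgM => //; exact: cvg_cst.
rewrite -A0; apply/cvgrPdist_lt => e e0.
have e3 : 0 < e / 3 by rewrite divr_gt0.
have /cvgrPdist_lt/(_ _ e3) hA := cvg_at_right_filter cA.
have e32 : D 0 < (e / 3) ^+ 2 by rewrite D0 exprn_gt0.
have hD := cvgr_lt _ (cvg_at_right_filter cD) _ e32.
(* eta is fixed before i: the radius dl and the sequences [a] and [d] depend on it. *)
near (0 : R)^'+ => eta.
have eta0 : 0 < eta by near: eta; exact: nbhs_right_gt.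
have eta1 : eta < 2^-1 by near: eta; apply: nbhs_right_lt; rewrite invr_gt0.
have Aeta : `|A 0 - A eta| < e / 3 by near: eta; exact: hA.
have Deta : D eta < (e / 3) ^+ 2 by near: eta; exact: hD.
have [dl /andP[dl0 dl1] cmp] := compar eta0.
have c_gt0 : 0 < th * (1 + eta) by rewrite mulr_gt0 // addr_gt0.
have k_ge0 : 0 <= th^-1 * (1 + eta).
  by rewrite mulr_ge0 ?invr_ge0 ?(ltW th0) // addr_ge0 // ltW.
have [a [d [ca cd hle]]] := kernel_step eta0 eta1 dl0 dl1 c_gt0 k_ge0
  (fun P B h1 h2 h3 => (cmp P B h1 h2 h3).1)
  (fun P B h1 h2 h3 => (cmp P B h1 h2 h3).2) M0.
have /cvgrPdist_lt/(_ _ e3) ha := ca.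
have hd := cvgr_lt _ cd _ Deta.
near=> i.
have h1 : `|A eta - a i| < e / 3 by near: i; exact: ha.
have h2 : `|a i - kernel_K p (N i) (X i) (Y i) / (N i)%:R| < e / 3.
  have hi : (kernel_K p (N i) (X i) (Y i) / (N i)%:R - a i) ^+ 2 < (e / 3) ^+ 2.
    apply: (@le_lt_trans _ _ (d i)); first by near: i; exact: hle.
    by near: i; exact: hd.
  rewrite distrC -(@ltr_pXn2r _ 2) ?nnegrE ?(ltW e3) //.
  by rewrite real_normK ?num_real.
have t1 := ler_distD (A eta) (A 0) (kernel_K p (N i) (X i) (Y i) / (N i)%:R).
have t2 := ler_distD (a i) (A eta) (kernel_K p (N i) (X i) (Y i) / (N i)%:R).
lra.
Unshelve. all: by end_near. Qed.

End Comparison.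
End FilterLimits.

(** * Universality at a point, then uniformly on compact sets *)

Section Universality.
Variables (R : realType) (mu : {finite_measure set (measurableTypeR R) -> \bar
  R}).
Variables (w : R -> R) (p : nat -> {poly R}).
Hypothesis w_density : is_ac_density mu w.
Hypothesis p_orth : is_orthonormal_polys mu p.
Hypothesis p_reg : is_regular p.
Local Notation leb := (@lebesgue_measure R).
Local Notation D := (`]-1, 1[%classic : set (measurableTypeR R)).
Local Notation om := (@cheb_weight R).
Variable x0 : R.
Hypothesis x0I : -1 < x0 < 1.
Hypothesis w0 : 0 < w x0.
Hypothesis wc : {for x0, continuous w}.
Hypothesis mu_ac : exists c d : R, [/\ c < x0, x0 < d &
  mrestr mu (measurable_itv `]c, d[) `<< lebesgue_measure].

Lemma cheb_weight_gt0 : 0 < om x0.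
Proof.
rewrite sqrtr_gt0 subr_gt0 -[ltLHS]real_normK ?num_real // expr_lt1 //.
by rewrite ltr_norml.
Qed.

Lemma functional_compare (eta : R) : 0 < eta ->
  exists2 dl, 0 < dl < 2 &
  (forall (P : {poly R}) (B : R),
    (forall t, -1 < t < 1 -> 0 <= P.[t]) -> 0 <= B ->
    (forall t, -1 < t < 1 -> ~ (`|t - x0| < 2 * dl) -> P.[t] <= B) ->
    weighted_integral mu (cst 1) P
      <= w x0 / om x0 * (1 + eta) * weighted_integral leb om P + B * fine (mu
        D) /\
    weighted_integral leb om P
      <= (w x0 / om x0)^-1 * (1 + eta) * weighted_integral mu (cst 1) P + B *
        2).
Proof.
move=> eta0; have o0 := cheb_weight_gt0; have [c [d [cx xd muac]]] := mu_ac.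
(* The solution of (1 + tau) / (1 - tau) = 1 + eta: both densities may vary by a factor between 1 -
   tau and 1 + tau. *)
pose tau := eta / (2 + eta).
have tau0 : 0 < tau by rewrite divr_gt0 // addr_gt0.
have tau1 : tau < 1 by rewrite ltr_pdivrMr ?addr_gt0 // mul1r ltrDr.
have t1 : 0 < 1 - tau by rewrite subr_gt0.
have t2 : 0 < 1 + tau by rewrite addr_gt0.
have etaE : (1 + tau) / (1 - tau) = 1 + eta.
  rewrite /tau; field; apply/andP; split; first by rewrite gt_eqF // addr_gt0.
  by rewrite addrK.
have near_le (f : R -> R) : 0 < f x0 -> {for x0, continuous f} ->
    \forall t \near x0, f x0 * (1 - tau) <= f t <= f x0 * (1 + tau).
  move=> f0 fc.
  have lo : f x0 * (1 - tau) < f x0 by rewrite gtr_pMr // gtrBl.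
  have hi : f x0 < f x0 * (1 + tau) by rewrite ltr_pMr // ltrDl.
  have h1 := cvgr_gt _ fc _ lo; have h2 := cvgr_lt _ fc _ hi.
  by near=> t; apply/andP; split; apply: ltW; near: t; [exact: h1|exact: h2].
have nw := near_le w w0 wc;
  have no := near_le om o0 (@continuous_cheb_weight R x0).
have nD : \forall t \near x0, t \in `]-1, 1[ by apply: near_in_itvoo;
  rewrite in_itv.
have ncd : \forall t \near x0, t \in `]c, d[.
  by apply: near_in_itvoo; rewrite in_itv /= cx.
have /nbhs_normP[r /= r0 hr] :
    \forall t \near x0, [/\ w x0 * (1 - tau) <= w t <= w x0 * (1 + tau),
      om x0 * (1 - tau) <= om t <= om x0 * (1 + tau), t \in `]-1, 1[ & t \in
        `]c, d[].
  by near=> t; split; near: t; [exact: nw|exact: no|exact: nD|exact: ncd].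
(* J has radius 2 dl <= r, and the bump needs dl < 2. *)
pose dl := Num.min (r / 2) 1.
have dl0 : 0 < dl by rewrite lt_min ltr01 divr_gt0.
have dlr : 2 * dl <= r by rewrite mulrC -ler_pdivlMr // ge_min lexx.
have dl2 : dl < 2 by rewrite gt_min ltr1n orbT.
exists dl; first by rewrite dl0.
move=> P B P0 B0 PB.
pose J : set (measurableTypeR R) := `]x0 - 2 * dl, x0 + 2 * dl[%classic.
have JE t : J t <-> `|t - x0| < 2 * dl by rewrite /J /= in_itv /= ltr_distl.
have Jr t : J t -> [/\ w x0 * (1 - tau) <= w t <= w x0 * (1 + tau),
      om x0 * (1 - tau) <= om t <= om x0 * (1 + tau), t \in `]-1, 1[ & t \in
        `]c, d[].
  by move=> /JE tJ; apply: hr; rewrite /= distrC (lt_le_trans tJ).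
have mJ : measurable J by exact: measurable_itv.
have JD : J `<=` `]-1, 1[%classic by move=> t /Jr[].
have Jac : mrestr mu mJ `<< lebesgue_measure.
  apply/null_content_dominatesP => A mA A0.
  have AJ : measurable (A `&` J) by exact: measurableI.
  have := (null_content_dominatesP _ _).1 muac (A `&` J) AJ.
  rewrite /mrestr (setIidl (_ : A `&` J `<=` `]c, d[%classic)); last first.
    by move=> t [_ /Jr[]].
  by apply; apply: subset_measure0 A0 => //; exact: subIsetl.
have PBJ t : -1 < t < 1 -> ~ J t -> P.[t] <= B.
  by move=> tI tJ; apply: PB => // /JE.
have ct0 : 0 <= w x0 * (1 + tau) by rewrite mulr_ge0 // ltW.
have co0 : 0 < om x0 * (1 - tau) by rewrite mulr_gt0.
have cw0 : 0 < w x0 * (1 - tau) by rewrite mulr_gt0.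
have cot0 : 0 <= om x0 * (1 + tau) by rewrite mulr_ge0 // ltW.
split.
- rewrite (_ : w x0 / om x0 * (1 + eta) =
    w x0 * (1 + tau) / (om x0 * (1 - tau))); last first.
    by rewrite -etaE; field; rewrite !gt_eqF.
  apply: (mu_le_cheb w_density JD Jac) => //.
  + by move=> t /Jr[/andP[]].
  + by move=> t /Jr[_ /andP[]].
- rewrite (_ : (w x0 / om x0)^-1 * (1 + eta) =
    om x0 * (1 + tau) / (w x0 * (1 - tau))); last first.
    by rewrite -etaE; field; rewrite !gt_eqF.
  apply: (cheb_le_mu w_density JD Jac) => //.
  + by move=> t /Jr[/andP[]].
  + by move=> t /Jr[_ /andP[]].
Unshelve. all: by end_near. Qed.

Section Limit.
Context {I : Type} {F : set_system I} {FF : Filter F}.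
Variable N : I -> nat.
Hypothesis Noo : forall k, \forall i \near F, (k <= N i)%N.

Lemma kernel_K_cvg (X Y : I -> R) (s : R) :
  X i @[i --> F] --> x0 -> Y i @[i --> F] --> x0 ->
  (N i)%:R * (X i - Y i) @[i --> F] --> s ->
  kernel_K p (N i) (X i) (Y i) / (N i)%:R @[i --> F] -->
    sinc (s / om x0) / (pi * om x0 * w x0).
Proof.
move=> Xx Yx XY; have o0 := cheb_weight_gt0; have [psz pl por] := p_orth.
have [||||Lmu LmuE mupos] := @weighted_functional R mu (cst 1).
- by rewrite ltey_eq fin_num_measure.
- exact: measurable_cst.
- by exists 1 => x _; rewrite normr1.
- by [].
have [||||Lom LomE ompos] := @weighted_functional R leb om.
- by rewrite [X in (X < _)%E]lebesgue_measure_itvN11 ltry.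
- exact: measurable_cheb_weight.
- by exists 1 => x _; rewrite ger0_norm ?cheb_weight_ge0 ?cheb_weight_le1.
- by move=> x _; exact: cheb_weight_ge0.
have muorth : orthonormal_for Lmu p.
  split=> // i j; apply: EFin_inj; rewrite LmuE mu_functionalE -por.
  by apply: eq_integral => x _; rewrite hornerM.
have omorth := chebu_orthonormal LomE.
have psub e (e0 : 0 < e) := orthonormal_subexponential mupos muorth pl p_reg e0.
have th0 : 0 < w x0 / om x0 by rewrite divr_gt0.
have M0 : 0 <= fine (mu D) by rewrite fine_ge0.
have compar eta : 0 < eta -> exists2 dl, 0 < dl < 2 &
  (forall (P : {poly R}) (B : R),
    (forall t, -1 < t < 1 -> 0 <= P.[t]) -> 0 <= B ->
    (forall t, -1 < t < 1 -> ~ (`|t - x0| < 2 * dl) -> P.[t] <= B) ->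
    Lmu P <= w x0 / om x0 * (1 + eta) * Lom P + B * fine (mu D) /\
    Lom P <= (w x0 / om x0)^-1 * (1 + eta) * Lmu P + B * 2).
  move=> /functional_compare[dl dlI h]; exists dl => // P B.
  by rewrite LmuE LomE; exact: h.
have := @kernel_cvg R I F FF N Noo Lmu Lom p mupos ompos muorth omorth psub
  x0 s X Y x0I Xx Yx XY (w x0 / om x0) (fine (mu D)) th0 M0 compar.
rewrite (_ : sinc (s / om x0) / (pi * om x0 ^+ 2) / (w x0 / om x0) =
  sinc (s / om x0) / (pi * om x0 * w x0)) //.
have p0 : pi != 0 :> R by rewrite gt_eqF ?pi_gt0.
move: (@pi R) p0 => q q0; field.
by rewrite q0 !gt_eqF.
Qed.

(** [kernel_K_cvg] is used twice: on the diagonal it gives the size of the normalizing factor, hence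
    the limit of N times the difference of the two shifted points; then it is applied at those
    points. *)
Lemma kernel_Kt_cvg (X A B : I -> R) (a b : R) :
  X i @[i --> F] --> x0 -> A i @[i --> F] --> a -> B i @[i --> F] --> b ->
  kernel_Kt w p (N i) (X i + A i / kernel_Kt w p (N i) (X i) (X i))
                      (X i + B i / kernel_Kt w p (N i) (X i) (X i))
    / kernel_Kt w p (N i) (X i) (X i) @[i --> F] --> sine_kernel a b.
Proof.
move=> Xx Aa Bb; have o0 := cheb_weight_gt0.
(* The limit of the normalized diagonal kernel over n is the arcsine density at x0, in which w has
   cancelled. *)
pose T : R := (pi * om x0)^-1.
have T0 : 0 < T by rewrite invr_gt0 mulr_gt0 // pi_gt0.
have sw (U : I -> R) : U i @[i --> F] --> x0 ->
    Num.sqrt (w (U i)) @[i --> F] --> Num.sqrt (w x0).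
  move=> Ux; apply: continuous_cvg; first exact: sqrt_continuous.
  exact: continuous_cvg.
have sww : Num.sqrt (w x0) * Num.sqrt (w x0) = w x0.
  by rewrite -expr2 sqr_sqrtr // ltW.
have sinc00 : sinc (0 : R) = 1 by rewrite /sinc eqxx.
pose q i := kernel_Kt w p (N i) (X i) (X i) / (N i)%:R.
have q_cvg : q i @[i --> F] --> T.
  rewrite (_ : T = Num.sqrt (w x0) * Num.sqrt (w x0) *
      (sinc (0 / om x0) / (pi * om x0 * w x0))); last first.
    rewrite sww mul0r sinc00 /T.
    have p0 : pi != 0 :> R by rewrite gt_eqF ?pi_gt0.
    by move: (@pi R) p0 => r r0; field; rewrite r0 !gt_eqF.
  apply: (@cvg_near_eq _ _ _ _ (fun i => Num.sqrt (w (X i)) * Num.sqrt (w (X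
    i)) *
      (kernel_K p (N i) (X i) (X i) / (N i)%:R))).
    by near=> i; rewrite /q /kernel_Kt mulrA.
  apply: cvgM; first by apply: cvgM; exact: sw.
  apply: kernel_K_cvg => //.
  by under eq_fun do rewrite subrr mulr0; exact: cvg_cst.
have qV : (q i)^-1 @[i --> F] --> T^-1 by apply: cvgV => //; rewrite gt_eqF.
have N0 : \forall i \near F, (N i)%:R != 0 :> R.
  by have := Noo 1; apply: filterS => i; rewrite pnatr_eq0 lt0n.
have invE : \forall i \near F, (kernel_Kt w p (N i) (X i) (X i))^-1 = (N
  i)%:R^-1 / q i.
  near=> i; rewrite /q invf_div mulKf //; near: i; exact: N0.
have inv0 : (kernel_Kt w p (N i) (X i) (X i))^-1 @[i --> F] --> 0.
  apply: (@cvg_near_eq _ _ _ _ (fun i => (N i)%:R^-1 / q i)).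
    by near=> i; apply/esym; near: i; exact: invE.
  by rewrite -(mul0r T^-1); apply: cvgM => //; exact: inv_cvg0.
have shift (U : I -> R) (u : R) : U i @[i --> F] --> u ->
    X i + U i / kernel_Kt w p (N i) (X i) (X i) @[i --> F] --> x0.
  by move=> Uu; rewrite -[X in _ --> X]addr0 -(mulr0 u); apply: cvgD => //;
    exact: cvgM.
have NXY : (N i)%:R * ((X i + A i / kernel_Kt w p (N i) (X i) (X i))
     - (X i + B i / kernel_Kt w p (N i) (X i) (X i))) @[i --> F] --> (a - b) /
       T.
  apply: (@cvg_near_eq _ _ _ _ (fun i => (A i - B i) / q i)); last first.
    by apply: cvgM => //; exact: cvgB.
  near=> i; rewrite opprD addrACA subrr add0r -mulrBl.
  have -> : (kernel_Kt w p (N i) (X i) (X i))^-1 = (N i)%:R^-1 / q i.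
    by near: i; exact: invE.
  by rewrite mulrCA mulVKf //; near: i; exact: N0.
have KXY := kernel_K_cvg (shift _ _ Aa) (shift _ _ Bb) NXY.
have limE : sine_kernel a b = Num.sqrt (w x0) * Num.sqrt (w x0) *
    (sinc ((a - b) / T / om x0) / (pi * om x0 * w x0)) / T.
  rewrite sww sine_kernelE /T.
  have p0 : pi != 0 :> R by rewrite gt_eqF ?pi_gt0.
  rewrite (_ : (a - b) / (pi * om x0)^-1 / om x0 = pi * (a - b)).
    move: (sinc (pi * (a - b))) => sn.
    by move: (@pi R) p0 => r r0; field; rewrite r0 !gt_eqF.
  by move: (@pi R) p0 => r r0; field; rewrite r0 !gt_eqF.
rewrite limE.
apply: (@cvg_near_eq _ _ _ _ (fun i =>
  Num.sqrt (w (X i + A i / kernel_Kt w p (N i) (X i) (X i))) *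
  Num.sqrt (w (X i + B i / kernel_Kt w p (N i) (X i) (X i))) *
  (kernel_K p (N i) (X i + A i / kernel_Kt w p (N i) (X i) (X i))
     (X i + B i / kernel_Kt w p (N i) (X i) (X i)) / (N i)%:R) / q i));
       last first.
  apply: cvgM => //; apply: cvgM => //.
  by apply: cvgM; apply: sw; [exact: shift Aa | exact: shift Bb].
near=> i.
have -> : (kernel_Kt w p (N i) (X i) (X i))^-1 = (N i)%:R^-1 / q i.
  by near: i; exact: invE.
by rewrite [in RHS]/kernel_Kt !mulrA.
Unshelve. all: by end_near. Qed.

End Limit.
End Universality.

Theorem theorem1p1 (R : realType)
  (mu : {finite_measure set (measurableTypeR R) -> \bar R})
  (w : R -> R) (p : nat -> {poly R}) (l r : R)
  (mu_on : lives_on `]-1, 1[%classic mu)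
  (mu_inf : infinite_set (support_of mu))
  (w_density : is_ac_density mu w)
  (p_orth : is_orthonormal_polys mu p)
  (p_reg : is_regular p)
  (l_gtN1 : -1 < l) (l_le_r : l <= r) (r_lt1 : r < 1)
  (mu_ac : exists c d : R, [/\ c < l, r < d &
     mrestr mu (measurable_itv `]c, d[) `<< lebesgue_measure])
  (w_pos : forall x : R, x \in `[l, r] -> 0 < w x)
  (w_cont : forall x : R, x \in `[l, r] -> {for x, continuous w}) :
  forall A B : set R, compact A -> compact B ->
    {uniform `[l, r]%classic `*` A `*` B,
      (fun (n : nat) (u : R * R * R) =>
         let: (x, a, b) := u in
         kernel_Kt w p n (x + a / kernel_Kt w p n x x)
                         (x + b / kernel_Kt w p n x x)
           / kernel_Kt w p n x x) @ \oo -->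
      (fun u : R * R * R => let: (_, a, b) := u in sine_kernel a b)}.
Proof.
move=> A B cA cB; set f := (fun (n : nat) (u : R * R * R) => _).
set g := (fun u : R * R * R => _).
have gE u : g u = sinc (pi * (u.1.2 - u.2)).
  by rewrite /g; case: u => -[x a] b /=; rewrite sine_kernelE.
have fE n u : f n u = kernel_Kt w p n (u.1.1 + u.1.2 / kernel_Kt w p n u.1.1
  u.1.1)
    (u.1.1 + u.2 / kernel_Kt w p n u.1.1 u.1.1) / kernel_Kt w p n u.1.1 u.1.1.
  by rewrite /f; case: u => -[x a] b.
have cK : compact (`[l, r]%classic `*` A `*` B).
  by apply: compact_setX => //; apply: compact_setX => //;
    exact: segment_compact.
move=> P /uniform_nbhs[E [/=]];
  rewrite -entourage_from_ballE => -[e /= e0 eE] EP.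
(* By compactness it suffices to take the joint limit of (x, a, b) and n at each
   point. *)
have key : \forall n \near \oo,
    (`[l, r]%classic `*` A `*` B) `<=` (fun u => `|g u - f n u| < e).
  apply: (compact_near_coveringP _).1 => // -[[x0 a0] b0] [[/= xI _] _].
  have /andP[lx xr] : l <= x0 <= r by move: xI; rewrite in_itv.
  have x0I : -1 < x0 < 1 by rewrite (lt_le_trans l_gtN1) ?(le_lt_trans xr).
  have ac0 : exists c d : R, [/\ c < x0, x0 < d &
     mrestr mu (measurable_itv `]c, d[) `<< lebesgue_measure].
    have [c [d [cl rd h]]] := mu_ac; exists c, d; split=> //.
      exact: lt_le_trans lx.
    exact: le_lt_trans rd.
  (* Points x near x0 are not confined to [l, r]; the assumptions used bear on x0 and on a full
     neighbourhood of it. *)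
  pose FF := filter_prod (nbhs (x0, a0, b0)) \oo.
  have FFF : Filter FF by exact: filter_prod_filter.
  have c1 : i.1 @[i --> FF] --> (x0, a0, b0) by exact: cvg_fst.
  have c2 : i.2 @[i --> FF] --> \oo by exact: cvg_snd.
  have c11 : i.1.1 @[i --> FF] --> (x0, a0) by apply: cvg_comp c1 _;
    exact: cvg_fst.
  have cx : i.1.1.1 @[i --> FF] --> x0 by apply: cvg_comp c11 _; exact: cvg_fst.
  have ca : i.1.1.2 @[i --> FF] --> a0 by apply: cvg_comp c11 _; exact: cvg_snd.
  have cb : i.1.2 @[i --> FF] --> b0 by apply: cvg_comp c1 _; exact: cvg_snd.
  have Noo k : \forall i \near FF, (k <= i.2)%N.
    exact: (c2 _ (nbhs_infty_ge k)).
  have /(_ FFF) lim := kernel_Kt_cvg w_density p_orth p_reg x0I (w_pos _ xI)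
    (w_cont _ xI)
    ac0 Noo cx ca cb.
  (* f is compared with g at the moving point, so continuity of the sine kernel is needed as
     well. *)
  have limg : g i.1 @[i --> FF] --> sine_kernel a0 b0.
    rewrite sine_kernelE.
    apply: (@cvg_near_eq _ _ _ _ (fun i => sinc (pi * (i.1.1.2 - i.1.2)))).
      by near=> i; rewrite gE.
    apply: continuous_cvg; first exact: continuous_sinc.
    by apply: cvgM; [exact: cvg_cst | exact: cvgB].
  have diff0 : g i.1 - f i.2 i.1 @[i --> FF] --> 0.
    rewrite -(subrr (sine_kernel a0 b0)); apply: cvgB => //.
    by apply: (cvg_near_eq _ lim); near=> i; rewrite fE.
  have /cvgrPdist_lt/(_ _ e0) := diff0.
  by apply: filterS => i; rewrite sub0r normrN.
apply: filterS key => n h; apply: EP => u /h uK; apply: eE.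
by rewrite /= /ball_.
Unshelve. all: by end_near. Qed.
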